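(* Let $(\mathcal{A},[\cdot,\cdot],\rho)$ be a Lie algebroid over a smooth manifold $M$, and let $\phi\in\Omega^k(\mathcal{A},\mathcal{A})$ and $\psi\in\Omega^l(\mathcal{A},\mathcal{A})$. Suppose $\nabla$ is a torsion-free $\mathcal{A}$-connection on $\mathcal{A}$. Then the Frölicher-Nijenhuis bracket of $\phi$ and $\psi$ is given by $$[\phi,\psi]_{FN}=\mathcal{L}^\nabla_\phi\psi-(-1)^{kl}\mathcal{L}^\nabla_\psi\phi.$$
   Context: For a vector bundle $E$ over $M$, $\Omega^k(\mathcal{A},E)=\Gamma(\wedge^k\mathcal{A}^*\otimes E)$ is the space of skew-symmetric $E$-valued $k$-forms on $\mathcal{A}$, and $\Omega^k(\mathcal{A})=\Omega^k(\mathcal{A},M\times\mathbb{R})$. $\mathrm{Sh}_{k,s}$ is the set of permutations $\sigma$ of $\{1,\dots,k+s\}$ with $\sigma(1)<\dots<\sigma(k)$ and $\sigma(k+1)<\dots<\sigma(k+s)$; $(-1)^\sigma$ is the sign of $\sigma$. All $Z_i$ are arbitrary sections of $\mathcal{A}$. Insertion: for $\phi\in\Omega^p(\mathcal{A},\mathcal{A})$ and $\psi\in\Omega^{k+1}(\mathcal{A},E)$, $i_\phi\psi\in\Omega^{p+k}(\mathcal{A},E)$ is $$(i_\phi\psi)(Z_1,\dots,Z_{p+k})=\sum_{\sigma\in\mathrm{Sh}_{p,k}}(-1)^\sigma\psi(\phi(Z_{\sigma(1)},\dots,Z_{\sigma(p)}),Z_{\sigma(p+1)},\dots,Z_{\sigma(p+k)}),$$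 and $i_\phi$ is zero on $\Omega^0(\mathcal{A},E)$. This applies to any vector bundle, in particular to $E=\mathcal{A}$ and to $E=M\times\mathbb{R}$. The operator $i_\phi$ has degree $p-1$. An $\mathcal{A}$-connection on $E$ is a map $\nabla:\Gamma(\mathcal{A})\times\Gamma(E)\to\Gamma(E)$ such that $\nabla_X$ is $\mathbb{R}$-linear, $X\mapsto\nabla_Xs$ is $C^\infty(M)$-linear, and $\nabla_X(fs)=(\rho(X)f)s+f\nabla_Xs$. An $\mathcal{A}$-connection on $\mathcal{A}$ is torsion-free if $\nabla_XY-\nabla_YX=[X,Y]$ for all $X,Y\in\Gamma(\mathcal{A})$. Given an $\mathcal{A}$-connection $\nabla^E$ on $E$, the covariant exterior derivative $d^\nabla:\Omega^p(\mathcal{A},E)\to\Omega^{p+1}(\mathcal{A},E)$ is $$(d^\nabla\phi)(Z_1,\dots,Z_{p+1})=\sum_{\sigma\in\mathrm{Sh}_{1,p}}(-1)^\sigma\nabla^E_{Z_{\sigma(1)}}(\phi(Z_{\sigma(2)},\dots,Z_{\sigma(p+1)}))-\sum_{\sigma\in\mathrm{Sh}_{2,p-1}}(-1)^\sigma\phi([Z_{\sigma(1)},Z_{\sigma(2)}],Z_{\sigma(3)},\dots,Z_{\sigma(p+1)}).$$ For $\phi\in\Omega^k(\mathcal{A},\mathcal{A})$, the covariant Lie derivative on $\Omega^*(\mathcal{A},E)$ is the operator of degree $k$ $$\mathcal{L}^\nabla_\phi=[i_\phi,d^\nabla]=i_\phi d^\nabla+(-1)^kd^\nabla i_\phi.$$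 On $\Omega^*(\mathcal{A},\mathcal{A})$ (as in $\mathcal{L}^\nabla_\phi\psi$, $\mathcal{L}^\nabla_\psi\phi$) it is formed with $E=\mathcal{A}$ and $\nabla^E=\nabla$ the given torsion-free connection. On $\Omega^*(\mathcal{A})$ it is formed with the connection $\nabla^\rho_Xf=\rho(X)f$ on the trivial line bundle $M\times\mathbb{R}$ (so that $d^\nabla$ is the Lie algebroid differential). The Frölicher-Nijenhuis bracket $[\phi,\psi]_{FN}\in\Omega^{k+l}(\mathcal{A},\mathcal{A})$ of $\phi\in\Omega^k(\mathcal{A},\mathcal{A})$ and $\psi\in\Omega^l(\mathcal{A},\mathcal{A})$ is defined (following Nijenhuis) by the equality of operators on $\Omega^*(\mathcal{A})$ $$[\mathcal{L}^\nabla_\phi,i_\psi]=i_{[\phi,\psi]_{FN}}-(-1)^{k(l-1)}\mathcal{L}^\nabla_{i_\psi\phi},$$ where $[A,B]=AB-(-1)^{ab}BA$ is the graded commutator of operators of degrees $a,b$; this determines $[\phi,\psi]_{FN}$ uniquely since $\phi\mapsto i_\phi$ is injective. *)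

(* Defs.v *)
From HB Require Import structures.
From mathcomp Require Import all_boot all_order all_algebra all_fingroup.
From mathcomp Require Import all_classical all_reals all_analysis.
Import Order.TTheory GRing.Theory Num.Theory numFieldNormedType.Exports.

Set Implicit Arguments.
Unset Strict Implicit.
Unset Printing Implicit Defensive.

Local Open Scope classical_set_scope.
Local Open Scope ring_scope.

Section SmoothEuclidean.
Variables (R : realType) (n : nat).
Implicit Types (U : set 'rV[R]_n) (f g : 'rV[R]_n -> R).

(* [f] and its iterated partial derivatives of order < [k] are (Frechet)
   differentiable at every point of [U]; meaningful for [U] open. *)
Fixpoint diff_upto (k : nat) U f : Prop :=
  if k is k'.+1 then
    (forall x, U x -> differentiable f x) /\
    (forall i : 'I_n, diff_upto k' U ('D_(delta_mx 0 i) f))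
  else True.

Definition smooth_rV U f := forall k, diff_upto k U f.

Lemma diff_uptoW k U f : diff_upto k.+1 U f -> diff_upto k U f.
Proof. by elim: k f => [//|k IH] f [df Df]; split=> // i; exact/IH/Df. Qed.

Lemma differentiable_near0 f x : {near x, f =1 cst 0} -> differentiable f x.
Proof.
move=> f0; have fx0 : f x = 0 by exact: (nbhs_singleton f0).
have oE : f \o shift x = cst (f x) + (\0 : 'rV[R]_n -> R) +o_ 0 id.
  apply/eqaddoP => e e0.
  have : \forall y \near 0, f (y + x) = 0.
    by move: f0; rewrite (near_shift 0) /= subr0.
  apply: filterS => y /= fy.
  rewrite !fctE /= fy fx0 !(addr0, subr0) normr0.
  exact: mulr_ge0 (ltW e0) (normr_ge0 _).
have c0 : continuous (\0 : 'rV[R]_n -> R) by exact: (@cst_continuous _ _ (0 : R)).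
by apply/diff_locallyP; rewrite (@diff_unique _ _ _ f \0 x c0 oE).
Qed.

Lemma near_eq_differentiable f g x :
  {near x, f =1 g} -> differentiable f x -> differentiable g x.
Proof.
move=> fg df; rewrite -[g](subrK f) addrC; apply: differentiableD => //.
by apply: differentiable_near0; apply: filterS fg => y fgy; rewrite !fctE fgy subrr.
Qed.

Lemma diff_upto_eq k U f g : open U -> (forall x, U x -> f x = g x) ->
  diff_upto k U f -> diff_upto k U g.
Proof.
move=> oU; elim: k f g => [//|k IH] f g fg [df Df].
have nfg x : U x -> {near x, f =1 g}.
  by move=> Ux; apply: filterS (open_nbhs_nbhs (conj oU Ux)) => y /fg.
split=> [x Ux|i]; first exact: near_eq_differentiable (nfg x Ux) (df x Ux).
by apply: IH (Df i) => x Ux; exact/near_eq_derive/nfg.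
Qed.

Lemma smooth_rV_cst U c : smooth_rV U (cst c).
Proof.
move=> k; elim: k c => [//|k IH] c; split=> [x _|i].
  exact: differentiable_cst.
suff -> : 'D_(delta_mx 0 i) (cst c : 'rV[R]_n -> R) = cst 0 by exact: IH.
by apply/funext => x; rewrite derive_cst.
Qed.

Lemma diff_uptoD k U f g : open U ->
  diff_upto k U f -> diff_upto k U g -> diff_upto k U (f + g).
Proof.
move=> oU; elim: k f g => [//|k IH] f g [df Df] [dg Dg]; split=> [x Ux|i].
  by apply: differentiableD; [exact: df|exact: dg].
apply: diff_upto_eq (IH _ _ (Df i) (Dg i)) => // x Ux.
by rewrite deriveD//; apply: diff_derivable; [exact: df|exact: dg].
Qed.

Lemma diff_uptoM k U f g : open U ->
  diff_upto k U f -> diff_upto k U g -> diff_upto k U (f * g).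
Proof.
move=> oU; elim: k f g => [//|k IH] f g sf sg.
have [[df Df] [dg Dg]] := (sf, sg); split=> [x Ux|i].
  by apply: differentiableM; [exact: df|exact: dg].
have := diff_uptoD oU (IH _ _ (diff_uptoW sf) (Dg i))
                      (IH _ _ (diff_uptoW sg) (Df i)).
apply: diff_upto_eq => // x Ux.
by rewrite deriveM//; apply: diff_derivable; [exact: df|exact: dg].
Qed.

Lemma smooth_rVD U f g : open U ->
  smooth_rV U f -> smooth_rV U g -> smooth_rV U (f + g).
Proof. by move=> oU sf sg k; apply: diff_uptoD. Qed.

Lemma smooth_rVM U f g : open U ->
  smooth_rV U f -> smooth_rV U g -> smooth_rV U (f * g).
Proof. by move=> oU sf sg k; apply: diff_uptoM. Qed.

End SmoothEuclidean.

(* Only the values of [chart_map] on [chart_dom], and of [chart_inv] on the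
   image of [chart_dom], are relevant. *)
Record chart (R : realType) (T : topologicalType) (n : nat) := Chart {
  chart_dom : set T;
  chart_map : T -> 'rV[R]_n;
  chart_inv : 'rV[R]_n -> T }.

Definition chart_image (R : realType) (T : topologicalType) (n : nat)
    (c : chart R T n) (U : set T) : set 'rV[R]_n :=
  chart_map c @` (U `&` chart_dom c).

Record smoothManifold (R : realType) := SmoothManifold {
  mfd_space :> topologicalType;
  mfd_dim : nat;
  mfd_atlas : set (chart R mfd_space mfd_dim);
  mfd_hausdorff : hausdorff_space mfd_space;
  mfd_second_countable : @second_countable mfd_space;
  mfd_chartP : forall c, mfd_atlas c ->
    [/\ open (chart_dom c), open (chart_image c setT),
        {within chart_dom c, continuous (chart_map c)},
        {within chart_image c setT, continuous (chart_inv c)}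
      & forall x, chart_dom c x -> chart_inv c (chart_map c x) = x];
  mfd_cover : forall x, exists2 c, mfd_atlas c & chart_dom c x;
  mfd_compat : forall c c', mfd_atlas c -> mfd_atlas c' ->
    forall j, smooth_rV (chart_image c (chart_dom c'))
                        (fun u => chart_map c' (chart_inv c u) 0 j) }.
Arguments mfd_atlas {R} M : rename.

Lemma chart_image_open (R : realType) (M : smoothManifold R)
    (c : chart R M (mfd_dim M)) (U : set M) :
  mfd_atlas M c -> open U -> open (chart_image c U).
Proof.
move=> cM oU; have [oD oI cmap cinv cK] := mfd_chartP cM.
have -> : chart_image c U = chart_image c setT `&` chart_inv c @^-1` U.
  apply/seteqP; split=> [_ [x [Ux Dx] <-]|_ [[x [_ Dx] <-]]] /=.
    by rewrite cK//; split=> //; exists x.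
  by rewrite cK// => Ux; exists x.
move: cinv; rewrite continuous_open_subspace// openE => cinv y [Vy Uy].
apply: filterI; first exact: open_nbhs_nbhs.
by apply: (cinv y); [rewrite inE|exact: open_nbhs_nbhs].
Qed.

(* For [U] open, [smooth_on U f] is smoothness of the restriction of [f] to
   [U]; the values of [f] outside [U] are irrelevant. *)
Definition smooth_on (R : realType) (M : smoothManifold R) (U : set M)
    (f : M -> R) : Prop :=
  forall c, mfd_atlas M c -> smooth_rV (chart_image c U) (f \o chart_inv c).

Section SmoothFunctions.
Variables (R : realType) (M : smoothManifold R).
Implicit Types (U : set M) (f g : M -> R).

Lemma smooth_on_cst U a : smooth_on U (cst a).
Proof. by move=> c _; exact: (@smooth_rV_cst _ _ _ a). Qed.

Lemma smooth_onD U f g : open U ->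
  smooth_on U f -> smooth_on U g -> smooth_on U (f \+ g).
Proof.
move=> oU sf sg c cM.
by apply: smooth_rVD; [exact: chart_image_open|exact: sf|exact: sg].
Qed.

Lemma smooth_onM U f g : open U ->
  smooth_on U f -> smooth_on U g -> smooth_on U (f \* g).
Proof.
move=> oU sf sg c cM.
by apply: smooth_rVM; [exact: chart_image_open|exact: sf|exact: sg].
Qed.

Lemma smooth_on_eq U f g : open U -> (forall x, U x -> f x = g x) ->
  smooth_on U f -> smooth_on U g.
Proof.
move=> oU fg sf c cM k; apply: diff_upto_eq (sf c cM k).
  exact: chart_image_open.
move=> _ [x [Ux Dx] <-] /=.
by have [_ _ _ _ ->] := mfd_chartP cM; rewrite ?fg.
Qed.

Lemma smooth_onS U V f : V `<=` U -> smooth_on U f -> smooth_on V f.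
Proof.
move=> VU sf c cM k; move: (sf c cM k).
have VU' : chart_image c V `<=` chart_image c U.
  by move=> _ [x [Vx Dx] <-]; exists x => //; split=> //; exact: VU.
elim: k (f \o _) => [//|k IH] h [dh Dh]; split=> [y /VU'|i]; first exact: dh.
exact/IH/Dh.
Qed.

(* The algebra C^oo(M). *)
Record smoothFun := SmoothFun {
  sfun :> M -> R;
  smooth_sfun : smooth_on setT sfun }.

Lemma smoothFunP (f g : smoothFun) : (forall x, f x = g x) -> f = g.
Proof.
case: f g => [f sf] [g sg] /= /funext fg; rewrite fg in sf *.
by congr SmoothFun; exact: Prop_irrelevance.
Qed.

Definition sfun_cst (a : R) : smoothFun := SmoothFun (@smooth_on_cst setT a).
Definition sfun_add (f g : smoothFun) :=
  SmoothFun (smooth_onD openT (smooth_sfun f) (smooth_sfun g)).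
Definition sfun_mul (f g : smoothFun) :=
  SmoothFun (smooth_onM openT (smooth_sfun f) (smooth_sfun g)).
Definition sfun_opp (f : smoothFun) := sfun_mul (sfun_cst (-1)) f.

HB.instance Definition _ := gen_eqMixin smoothFun.
HB.instance Definition _ := gen_choiceMixin smoothFun.

Fact sfun_addA : associative sfun_add.
Proof. by move=> f g h; apply: smoothFunP => x /=; rewrite addrA. Qed.
Fact sfun_addC : commutative sfun_add.
Proof. by move=> f g; apply: smoothFunP => x /=; rewrite addrC. Qed.
Fact sfun_add0 : left_id (sfun_cst 0) sfun_add.
Proof. by move=> f; apply: smoothFunP => x /=; rewrite add0r. Qed.
Fact sfun_addN : left_inverse (sfun_cst 0) sfun_opp sfun_add.
Proof. by move=> f; apply: smoothFunP => x /=; rewrite mulN1r addNr. Qed.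
HB.instance Definition _ := GRing.isZmodule.Build smoothFun
  sfun_addA sfun_addC sfun_add0 sfun_addN.

Fact sfun_mulA : associative sfun_mul.
Proof. by move=> f g h; apply: smoothFunP => x /=; rewrite mulrA. Qed.
Fact sfun_mulC : commutative sfun_mul.
Proof. by move=> f g; apply: smoothFunP => x /=; rewrite mulrC. Qed.
Fact sfun_mul1 : left_id (sfun_cst 1) sfun_mul.
Proof. by move=> f; apply: smoothFunP => x /=; rewrite mul1r. Qed.
Fact sfun_mulDl : left_distributive sfun_mul sfun_add.
Proof. by move=> f g h; apply: smoothFunP => x /=; rewrite mulrDl. Qed.
HB.instance Definition _ := GRing.Zmodule_isComPzRing.Build smoothFun
  sfun_mulA sfun_mulC sfun_mul1 sfun_mulDl.

End SmoothFunctions.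
Notation "a %:Sf" := (sfun_cst _ a) (at level 2, format "a %:Sf") : ring_scope.

(* Only the values of [triv_map] and [triv_inv] over [triv_dom] are
   relevant. *)
Record trivialization (R : realType) (M : smoothManifold R)
    (E : M -> lmodType R) (r : nat) := Trivialization {
  triv_dom : set M;
  triv_map : forall x, E x -> 'rV[R]_r;
  triv_inv : forall x, 'rV[R]_r -> E x }.

Arguments triv_map {R M E r} t {x} _.
Arguments triv_inv {R M E r} t x _.

(* A vector bundle is given by its fibres together with a smoothly compatible
   covering family of local trivializations; these determine the topology and
   the smooth structure of the total space. *)
Record vectorBundle (R : realType) (M : smoothManifold R) := VectorBundle {
  vb_rank : nat;
  vb_fiber :> M -> lmodType R;
  vb_trivs : set (trivialization vb_fiber vb_rank);
  vb_trivP : forall t, vb_trivs t -> open (triv_dom t) /\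
    forall x, triv_dom t x ->
      [/\ linear (@triv_map R M vb_fiber vb_rank t x),
          cancel (triv_map t) (triv_inv t x)
        & cancel (triv_inv t x) (triv_map t)];
  vb_cover : forall x, exists2 t, vb_trivs t & triv_dom t x;
  vb_compat : forall t t', vb_trivs t -> vb_trivs t' ->
    forall v j, smooth_on (triv_dom t `&` triv_dom t')
                          (fun x => triv_map t' (triv_inv t x v) 0 j) }.

Definition smooth_section_on (R : realType) (M : smoothManifold R)
    (E : vectorBundle M) (U : set M) (s : forall x, E x) : Prop :=
  forall t, vb_trivs t -> forall j,
    smooth_on (U `&` triv_dom t) (fun x => triv_map t (s x) 0 j).

Section Sections.
Variables (R : realType) (M : smoothManifold R) (E : vectorBundle M).
Notation C := (smoothFun M).

Let oT t : vb_trivs t -> open ([set: M] `&` @triv_dom _ _ E _ t).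
Proof. by move=> /vb_trivP[]; rewrite setTI. Qed.

(* The C^oo(M)-module of smooth sections of [E]; real scalars act through
   constant functions. *)
Record Gamma := MkSection {
  sec :> forall x, E x;
  smooth_sec : smooth_section_on setT sec }.

Lemma GammaP (s t : Gamma) : (forall x, s x = t x) -> s = t.
Proof.
case: s t => [s ss] [t st] /= stE.
have e : s = t by apply: functional_extensionality_dep.
by rewrite e in ss *; congr MkSection; exact: Prop_irrelevance.
Qed.

Section TrivLinear.
Variables (t : trivialization E (vb_rank E)) (x : M).
Hypotheses (tE : vb_trivs t) (tx : triv_dom t x).

Fact triv_linear a (u v : E x) :
  triv_map t (a *: u + v) = a *: triv_map t u + triv_map t v.
Proof. by have [_ /(_ x tx)[tl _ _]] := vb_trivP tE; exact: tl. Qed.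

Fact triv0 : triv_map t (0 : E x) = 0.
Proof.
by have := triv_linear (-1) 0 0; rewrite scaler0 addr0 scaleN1r addNr.
Qed.

Fact trivD (u v : E x) : triv_map t (u + v) = triv_map t u + triv_map t v.
Proof. by rewrite -[u]scale1r triv_linear !scale1r. Qed.

Fact trivZ a (u : E x) : triv_map t (a *: u) = a *: triv_map t u.
Proof. by rewrite -[a *: u]addr0 triv_linear triv0 addr0. Qed.
End TrivLinear.

Fact smooth_sec0 : smooth_section_on setT (fun x => 0 : E x).
Proof.
move=> t tE j; apply: smooth_on_eq (@smooth_on_cst _ _ _ 0); first exact: oT.
by move=> x [_ tx]; rewrite triv0// mxE.
Qed.

Fact smooth_secD (s1 s2 : Gamma) :
  smooth_section_on setT (fun x => s1 x + s2 x).
Proof.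
move=> t tE j; have oU := oT tE.
apply: smooth_on_eq (smooth_onD oU (smooth_sec s1 tE j) (smooth_sec s2 tE j)) => //.
by move=> x [_ tx]; rewrite trivD// mxE.
Qed.

Fact smooth_secZ (f : C) (s : Gamma) :
  smooth_section_on setT (fun x => f x *: s x).
Proof.
move=> t tE j; have oU := oT tE.
have sf : smooth_on ([set: M] `&` triv_dom t) f.
  by apply: smooth_onS (smooth_sfun f) => x [].
apply: smooth_on_eq (smooth_onM oU sf (smooth_sec s tE j)) => //.
by move=> x [_ tx]; rewrite trivZ// mxE.
Qed.

Definition sec0 := MkSection smooth_sec0.
Definition sec_add (s1 s2 : Gamma) := MkSection (smooth_secD s1 s2).
Definition sec_scale (f : C) (s : Gamma) := MkSection (smooth_secZ f s).
Definition sec_opp := sec_scale (-1).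

HB.instance Definition _ := gen_eqMixin Gamma.
HB.instance Definition _ := gen_choiceMixin Gamma.

Fact sec_addA : associative sec_add.
Proof. by move=> s1 s2 s3; apply: GammaP => x /=; rewrite addrA. Qed.
Fact sec_addC : commutative sec_add.
Proof. by move=> s1 s2; apply: GammaP => x /=; rewrite addrC. Qed.
Fact sec_add0 : left_id sec0 sec_add.
Proof. by move=> s; apply: GammaP => x /=; rewrite add0r. Qed.
Fact sec_addN : left_inverse sec0 sec_opp sec_add.
Proof.
by move=> s; apply: GammaP => x /=; rewrite mulr1 scaleN1r addNr.
Qed.
HB.instance Definition _ := GRing.isZmodule.Build Gamma
  sec_addA sec_addC sec_add0 sec_addN.

Fact sec_scaleA f g s : sec_scale f (sec_scale g s) = sec_scale (f * g) s.
Proof. by apply: GammaP => x /=; rewrite scalerA. Qed.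
Fact sec_scale1 : left_id 1 sec_scale.
Proof. by move=> s; apply: GammaP => x /=; rewrite scale1r. Qed.
Fact sec_scaleDr : right_distributive sec_scale +%R.
Proof. by move=> f s1 s2; apply: GammaP => x /=; rewrite scalerDr. Qed.
Fact sec_scaleDl s : {morph sec_scale^~ s : f g / f + g}.
Proof. by move=> f g; apply: GammaP => x /=; rewrite scalerDl. Qed.
HB.instance Definition _ := GRing.Zmodule_isLmodule.Build C Gamma
  sec_scaleA sec_scale1 sec_scaleDr sec_scaleDl.

End Sections.
Arguments Gamma {R M} E.

Section TrivialLine.
Variables (R : realType) (M : smoothManifold R).

Definition line_fiber (x : M) : lmodType R := R^o.

Definition line_triv : trivialization line_fiber 1 :=
  Trivialization setT (fun x (a : line_fiber x) => const_mx (a : R))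
    (fun x v => (v 0 0 : line_fiber x)).

Fact line_trivP t : [set line_triv] t -> open (triv_dom t) /\
  forall x, triv_dom t x ->
    [/\ linear (@triv_map R M line_fiber 1 t x),
        cancel (triv_map t) (triv_inv t x) & cancel (triv_inv t x) (triv_map t)].
Proof.
move=> ->; split=> [|x _]; first exact: openT.
split=> [a u v|a|v] /=.
- by apply/matrixP => i j; rewrite !mxE.
- by rewrite mxE.
- by apply/matrixP => i j; rewrite !mxE !ord1.
Qed.

Fact line_cover (x : M) : exists2 t, [set line_triv] t & triv_dom t x.
Proof. by exists line_triv. Qed.

Fact line_compat t t' : [set line_triv] t -> [set line_triv] t' ->
  forall v j, smooth_on (triv_dom t `&` triv_dom t')
                        (fun x => triv_map t' (triv_inv t x v) 0 j).
Proof.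
move=> -> -> v j; rewrite setIT /=.
by apply: smooth_on_eq openT _ (@smooth_on_cst _ _ _ (v 0 0)) => x _; rewrite mxE.
Qed.

Definition line_bundle : vectorBundle M :=
  VectorBundle line_trivP line_cover line_compat.

(* The identification of C^oo(M) with the sections of M x R. *)
Fact smooth_sec_of_fun (f : smoothFun M) :
  smooth_section_on setT (fun x => f x : line_bundle x).
Proof.
move=> t -> j; rewrite setIT.
by apply: smooth_on_eq openT _ (smooth_sfun f) => x _; rewrite /= mxE.
Qed.
Definition sec_of_fun (f : smoothFun M) : Gamma line_bundle :=
  MkSection (smooth_sec_of_fun f).

Fact smooth_fun_of_sec (s : Gamma line_bundle) :
  smooth_on setT (fun x => s x : R).
Proof.
have := @smooth_sec _ _ _ s line_triv erefl 0; rewrite setIT.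
by apply: smooth_on_eq openT _ => x _; rewrite /= mxE.
Qed.
Definition fun_of_sec (s : Gamma line_bundle) : smoothFun M :=
  SmoothFun (smooth_fun_of_sec s).

End TrivialLine.
Arguments line_bundle {R} M.

(* Tangent vectors at [x], as derivations of C^oo(M) at [x]. *)
Definition tangent_vector (R : realType) (M : smoothManifold R) (x : M)
    (D : smoothFun M -> R) : Prop :=
  (forall (a : R) f g, D (a%:Sf * f + g) = a * D f + D g) /\
  (forall f g, D (f * g) = f x * D g + D f * g x).

(* The anchor is a smooth bundle map [A -> TM]: a fibrewise linear map to
   tangent vectors taking smooth sections to smooth vector fields, i.e. to
   fields mapping smooth functions to smooth functions. *)
Record lieAlgebroid (R : realType) (M : smoothManifold R) := LieAlgebroid {
  la_bundle :> vectorBundle M;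
  anchor : forall x, la_bundle x -> smoothFun M -> R;
  anchor_tangent : forall x (u : la_bundle x), tangent_vector x (anchor u);
  anchor_linear : forall x f (a : R) (u v : la_bundle x),
    anchor (a *: u + v) f = a * anchor u f + anchor v f;
  anchor_smooth : forall (X : Gamma la_bundle) f,
    smooth_on setT (fun x => anchor (X x) f);
  bracket : Gamma la_bundle -> Gamma la_bundle -> Gamma la_bundle;
  bracket_linear : forall (a : R) X Y Z,
    bracket (a%:Sf *: X + Y) Z = a%:Sf *: bracket X Z + bracket Y Z;
  bracket_skew : forall X Y, bracket X Y = - bracket Y X;
  bracket_jacobi : forall X Y Z,
    bracket X (bracket Y Z) + bracket Y (bracket Z X)
      + bracket Z (bracket X Y) = 0;
  bracket_leibniz : forall X (f : smoothFun M) Y,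
    bracket X (f *: Y)
      = f *: bracket X Y + SmoothFun (anchor_smooth X f) *: Y }.

Section Connections.
Variables (R : realType) (M : smoothManifold R) (A : lieAlgebroid M).

Definition rho (X : Gamma A) (f : smoothFun M) : smoothFun M :=
  SmoothFun (anchor_smooth X f).

Record connection (E : vectorBundle M) := Connection {
  cov :> Gamma A -> Gamma E -> Gamma E;
  cov_Rlinear : forall X (a : R) s t,
    cov X (a%:Sf *: s + t) = a%:Sf *: cov X s + cov X t;
  cov_Clinear : forall (f : smoothFun M) X Y s,
    cov (f *: X + Y) s = f *: cov X s + cov Y s;
  cov_leibniz : forall X f s,
    cov X (f *: s) = rho X f *: s + f *: cov X s }.

Definition torsion_free (nabla : connection A) : Prop :=
  forall X Y, nabla X Y - nabla Y X = bracket X Y.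

(* The connection [X, f |-> rho(X) f] on M x R. *)
Definition nabla_rho (X : Gamma A) (s : Gamma (line_bundle M)) :=
  sec_of_fun (rho X (fun_of_sec s)).

Fact nabla_rho_Rlinear X (a : R) s t :
  nabla_rho X (a%:Sf *: s + t) = a%:Sf *: nabla_rho X s + nabla_rho X t.
Proof.
apply: GammaP => x /=; have [lin _] := anchor_tangent (X x).
rewrite -[RHS]lin; congr anchor; exact: smoothFunP.
Qed.

Fact nabla_rho_Clinear (f : smoothFun M) X Y s :
  nabla_rho (f *: X + Y) s = f *: nabla_rho X s + nabla_rho Y s.
Proof. by apply: GammaP => x /=; rewrite anchor_linear. Qed.

Fact nabla_rho_leibniz X f s :
  nabla_rho X (f *: s) = rho X f *: s + f *: nabla_rho X s.
Proof.
apply: GammaP => x /=; have [_ leib] := anchor_tangent (X x).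
rewrite addrC -[RHS]leib; congr anchor; exact: smoothFunP.
Qed.

Definition connection_rho : connection (line_bundle M) :=
  Connection nabla_rho_Rlinear nabla_rho_Clinear nabla_rho_leibniz.

End Connections.
Arguments connection_rho {R M} A.

(* An element of [Omega^*(A, E)] is represented by its values
   [omega(Z_1, ..., Z_n)] on sections, as a function of the list
   [[:: Z_1; ...; Z_n]]; the degree-[k] part is the restriction to lists of
   length [k]. *)
Definition cochain (R : realType) (M : smoothManifold R) (A : lieAlgebroid M)
    (E : vectorBundle M) := seq (Gamma A) -> Gamma E.

Section Forms.
Variables (R : realType) (M : smoothManifold R) (A : lieAlgebroid M).

Definition multilinear_skew (k : nat) (V W : lmodType R)
    (T : ('I_k -> V) -> W) : Prop :=
  (forall (v : 'I_k -> V) i (a : R) u w,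
     T [eta v with i |-> a *: u + w]
       = a *: T [eta v with i |-> u] + T [eta v with i |-> w]) /\
  (forall (v : 'I_k -> V) (s : 'S_k), T (v \o s) = (-1) ^+ s *: T v).

(* [T] is a smooth section of [wedge^k A^* (x) E]: its components in local
   frames of [A] and [E] are smooth functions. *)
Definition smooth_tensor (E : vectorBundle M) (k : nat)
    (T : forall x, ('I_k -> A x) -> E x) : Prop :=
  (forall x, multilinear_skew (T x)) /\
  (forall t : trivialization A (vb_rank A), vb_trivs t ->
     forall w : 'I_k -> 'rV[R]_(vb_rank A),
       smooth_section_on (triv_dom t)
         (fun x => T x (fun i => triv_inv t x (w i)))).

(* [Omega^k(A, E)]: homogeneous elements of degree [k], given on lists of
   length [k] by a smooth section of [wedge^k A^* (x) E]. *)
Definition Omega (k : nat) (E : vectorBundle M) : set (cochain A E) :=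
  [set omega : cochain A E | (forall Z, size Z <> k -> omega Z = 0) /\
    exists2 T : forall x, ('I_k -> A x) -> E x, smooth_tensor T
      & forall (Z : seq (Gamma A)) x, size Z = k -> omega Z x = T x (fun i => Z`_i x)].

(* (k, s)-shuffles, indexed from 0. *)
Definition Sh (k s : nat) : {set 'S_(k + s)} :=
  [set sigma : 'S_(k + s) | [forall i : 'I_(k + s), forall j : 'I_(k + s),
     (i < j)%N && ((j < k)%N || (k <= i)%N) ==> (sigma i < sigma j)%N]].

(* [sum_(sigma in Sh k s) (-1)^sigma
      F (Z_sigma(1), ..., Z_sigma(k)) (Z_sigma(k+1), ..., Z_sigma(k+s))]
   with [k + s = size Z]; the sum is empty when [size Z < k]. *)
Definition shuffle_sum (V : zmodType) (k : nat)
    (F : seq (Gamma A) -> seq (Gamma A) -> V) (Z : seq (Gamma A)) : V :=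
  if (k <= size Z)%N then
    \sum_(sigma in Sh k (size Z - k))
      let Zs := [seq Z`_(sigma i) | i <- enum 'I_(k + (size Z - k))] in
      F (take k Zs) (drop k Zs) *~ (-1) ^+ sigma
  else 0.

(* [i_phi], for [phi] of degree [p]. A degree-[m] form is evaluated on lists
   of length [m], so that [i_phi omega] is evaluated on lists of length
   [p + m - 1]; in particular [i_phi] is zero on forms of degree 0. *)
Definition insertion (E : vectorBundle M) (p : nat) (phi : cochain A A)
    (omega : cochain A E) : cochain A E :=
  shuffle_sum p (fun Y Y' => omega (phi Y :: Y')).

Definition d_nabla (E : vectorBundle M) (nabla : connection A E)
    (omega : cochain A E) : cochain A E := fun Z =>
  shuffle_sum 1 (fun Y Y' => nabla Y`_0 (omega Y')) Z
  - shuffle_sum 2 (fun Y Y' => omega (bracket Y`_0 Y`_1 :: Y')) Z.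

(* Graded commutator of operators of degrees [a] and [b]. *)
Definition gcomm (E : vectorBundle M) (a b : int)
    (P Q : cochain A E -> cochain A E) (omega : cochain A E) : cochain A E :=
  P (Q omega) - Q (P omega) *~ (-1) ^ (a * b).

Definition lie_nabla (E : vectorBundle M) (nabla : connection A E) (k : nat)
    (phi : cochain A A) : cochain A E -> cochain A E :=
  gcomm (k%:Z - 1) 1 (insertion k phi) (d_nabla nabla).

(* [chi] is the Frolicher-Nijenhuis bracket of [phi] and [psi], of degrees
   [k] and [l]. The form [i_psi phi] has degree [k + l - 1]; it is zero when
   [k = 0], so that the truncated predecessor is harmless. *)
Definition is_FN_bracket (k l : nat) (phi psi chi : cochain A A) : Prop :=
  let L := lie_nabla (connection_rho A) in
  Omega (k + l) chi /\
  forall m (omega : cochain A (line_bundle M)), Omega m omega ->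
    gcomm k%:Z (l%:Z - 1) (L k phi) (insertion l psi) omega
    = insertion (k + l) chi omega
      - L (k + l).-1 (insertion l psi phi) omega
          *~ (-1) ^ (k%:Z * (l%:Z - 1)).

End Forms.

(* Main.v *)
(** Let [d] be the covariant exterior derivative, [i_f] insertion, [D_f] the
    derivation [w |-> sum +- (nabla_(f Y) w)(Y')], the sum running over the
    splittings of the arguments into [Y] and [Y']. For every section [z], the
    contraction [iota_z] commutes with [i_f] and [D_f] up to operators of the same kind
    (with [f] or [w] replaced by its contraction, or [f] by [Y |-> nabla_(f Y) z]).
    Hence, by induction on the number of arguments,
      [ [i_f, i_g] = i_(i_f g) -+ i_(i_g f) ]  and
      [ [D_f, i_g] = i_(D_f g) -+ D_(i_g f) ],
    without any curvature term. Torsion-freeness says that [d = D_1] for the identity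
    1-form [1], so the second identity gives [L_f = D_f + (-1)^k i_(d f)]; substituting
    this into [ [L_f, i_g] ] yields the bracket formula.

    That the right-hand side is a smooth tensor follows from its being alternating and
    linear over smooth functions, by means of cut-off functions; these also supply
    enough 1-forms for [f |-> i_f] to be injective. *)

Require Import Defs.
From HB Require Import structures.
From mathcomp Require Import all_boot all_order all_algebra all_fingroup.
From mathcomp Require Import all_classical all_reals all_analysis.
From mathcomp Require Import ring lra zify.
Import Order.TTheory GRing.Theory Num.Theory numFieldNormedType.Exports.

Set Implicit Arguments.
Unset Strict Implicit.
Unset Printing Implicit Defensive.

Local Open Scope classical_set_scope.
Local Open Scope ring_scope.

(* The square-zero extension of [int] by an abelian group [V]. It embeds [V] additively
   into a commutative ring, so that [ring] decides linear identities in [V]. *)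
Definition trivext (V : zmodType) : Type := (int * V)%type.
HB.instance Definition _ (V : zmodType) := GRing.Zmodule.on (trivext V).
Section Trivext.
Variable V : zmodType.

Definition te_mul (x y : trivext V) : trivext V :=
  (x.1 * y.1, y.2 *~ x.1 + x.2 *~ y.1).
Definition te_one : trivext V := (1, 0).
Fact te_mulA : associative te_mul.
Proof. move=> [a u] [b v] [c w]; congr pair => /=; first by rewrite mulrA.
by rewrite !mulrzDl -!mulrzA addrA [b * a]mulrC [c * a]mulrC. Qed.
Fact te_mulC : commutative te_mul.
Proof. by move=> [a u] [b v]; congr pair => /=; rewrite 1?mulrC 1?addrC. Qed.
Fact te_mul1 : left_id te_one te_mul.
Proof. by move=> [a u]; congr pair => /=; rewrite ?mul1r // mulr1z mul0rz addr0. Qed.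
Fact te_mulD : left_distributive te_mul +%R.
Proof. move=> [a u] [b v] [c w]; congr pair => /=; first by rewrite mulrDl.
by rewrite mulrzDr mulrzDl addrACA. Qed.
HB.instance Definition _ := GRing.Zmodule_isComPzRing.Build (trivext V)
  te_mulA te_mulC te_mul1 te_mulD.
Definition te_in (v : V) : trivext V := (0, v).
Fact te_inD : zmod_morphism te_in. Proof. by move=> u v; congr pair; rewrite subrr. Qed.
HB.instance Definition _ := GRing.isZmodMorphism.Build V (trivext V) te_in te_inD.
Lemma te_inj : injective te_in. Proof. by move=> u v []. Qed.
End Trivext.

Ltac zmod := apply: te_inj; ring.

(** Signs are carried as booleans: a case split on the parities involved turns a signed identity
    into a linear one, which [zmod] decides. *)
Definition sg (V : zmodType) (b : bool) (v : V) : V := if b then - v else v.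
Arguments sg {V} !b v /.

Lemma sg0 (V : zmodType) b : sg b (0 : V) = 0.
Proof. by case: b; rewrite //= oppr0. Qed.

Lemma sgE (T : Type) (V : zmodType) b (f : T -> V) x : sg b f x = sg b (f x).
Proof. by case: b. Qed.

Lemma fun_addE (T : Type) (V : zmodType) (f g : T -> V) x : (f + g) x = f x + g x.
Proof. by []. Qed.

Lemma fun_oppE (T : Type) (V : zmodType) (f : T -> V) x : (- f) x = - f x.
Proof. by []. Qed.

Definition funE := (fun_addE, fun_oppE, sgE).

(** * Signed sums over splittings, insertion and covariant derivation *)

Section SplitSum.
Variables (L : Type) (V : zmodType).
Implicit Types (F G : seq L -> seq L -> V) (Z : seq L).

(** Signed sum over all splittings of [Z] into two subsequences, of whatever sizes. The head of [Z]
    joins the first block at no cost, or heads the second one after crossing the [size Y] arguments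
    of the first. This recursion replaces sums over shuffles ([shuffle_sumE]) and makes contraction
    with the head compute. *)
Fixpoint split_sum F Z : V :=
  if Z is z :: Z' then
    split_sum (fun Y Y' => F (z :: Y) Y') Z'
    + split_sum (fun Y Y' => sg (odd (size Y)) (F Y (z :: Y'))) Z'
  else F [::] [::].

Lemma eq_split_sum F G Z :
  (forall Y Y', (size Y + size Y')%N = size Z -> F Y Y' = G Y Y') ->
  split_sum F Z = split_sum G Z.
Proof.
elim: Z F G => [|z Z IH] F G FG /=; first exact: FG.
by congr (_ + _); apply: IH => Y Y' e; rewrite FG//= ?addnS ?addSn e.
Qed.

Lemma split_sumD F G Z : split_sum (F + G) Z = split_sum F Z + split_sum G Z.
Proof.
elim: Z F G => [//|z Z IH] F G /=; rewrite [RHS]addrACA.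
rewrite -[X in _ = X + _]IH -[X in _ = _ + X]IH; congr (_ + _).
by apply: eq_split_sum => Y Y' _; rewrite !fctE; case: (odd _) => //=; zmod.
Qed.

Lemma split_sumN F Z : split_sum (- F) Z = - split_sum F Z.
Proof.
elim: Z F => [//|z Z IH] F /=; rewrite opprD -!IH; congr (_ + _).
by apply: eq_split_sum => Y Y' _; rewrite !fctE; case: (odd _).
Qed.

Lemma split_sum_sg b F Z :
  split_sum (fun Y Y' => sg b (F Y Y')) Z = sg b (split_sum F Z).
Proof. by case: b => //=; rewrite -split_sumN. Qed.

Lemma split_sum0 F Z :
  (forall Y Y', (size Y + size Y')%N = size Z -> F Y Y' = 0) ->
  split_sum F Z = 0.
Proof.
elim: Z F => [|z Z IH] F F0 /=; first exact: F0.
by rewrite !IH ?addr0// => Y Y' e; rewrite F0 ?sg0//= ?addnS ?addSn e.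
Qed.

Lemma split_sum_whole F Z : (forall Y z Y', F Y (z :: Y') = 0) ->
  split_sum F Z = F Z [::].
Proof.
elim: Z F => [//|z Z IH] F F0 /=; rewrite IH// [X in _ + X]split_sum0 ?addr0//.
by move=> Y Y' _; rewrite F0 sg0.
Qed.

Lemma split_sum_nil F Z : (forall y Y Y', F (y :: Y) Y' = 0) ->
  split_sum F Z = F [::] Z.
Proof.
elim: Z F => [//|y Z IH] F F0 /=; rewrite split_sum0 ?add0r// IH// => *.
by rewrite F0 sg0.
Qed.
End SplitSum.

Lemma split_sum_morph (L : Type) (U V : zmodType) (h : U -> V)
    (F : seq L -> seq L -> U) Z : {morph h : u v / u + v} ->
  h (split_sum F Z) = split_sum (fun Y Y' => h (F Y Y')) Z.
Proof.
move=> hD; have h0 : h 0 = 0 by apply: (addrI (h 0)); rewrite -hD !addr0.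
have hN u : h (- u) = - h u by apply: (addrI (h u)); rewrite -hD !subrr h0.
elim: Z F => [//|z Z IH] F /=; rewrite hD !IH; congr (_ + _).
by apply: eq_split_sum => Y Y' _; case: (odd _); rewrite //= hN.
Qed.

Definition iota_ (L : Type) (V : Type) (z : L) (w : seq L -> V) : seq L -> V :=
  fun Z => w (z :: Z).

Lemma iota_add (L : Type) (V : zmodType) z (w1 w2 : seq L -> V) :
  iota_ z (w1 + w2) = iota_ z w1 + iota_ z w2.
Proof. by []. Qed.

Lemma iota_opp (L : Type) (V : zmodType) z (w : seq L -> V) :
  iota_ z (- w) = - iota_ z w.
Proof. by []. Qed.

Lemma iota_sg (L : Type) (V : zmodType) z b (w : seq L -> V) :
  iota_ z (sg b w) = sg b (iota_ z w).
Proof. by case: b. Qed.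

Definition iotaE := (iota_add, iota_opp, iota_sg).

(** * Alternating forms and contraction *)

Section Forms.
Variables (L V : zmodType).
Implicit Types w : seq L -> V.

Definition skewsym w :=
  forall s x y t, w (s ++ [:: x, y & t]) = - w (s ++ [:: y, x & t]).
(** Together with skew-symmetry, a condition on the first slot governs every slot. *)
Definition additive1 w := forall x y t, w (x + y :: t) = w (x :: t) + w (y :: t).
Definition alternating w := skewsym w /\ additive1 w.

(** The signs below depend on degrees modulo 2 only, and contraction flips the parity. *)
Definition parity (b : bool) w := forall Z, odd (size Z) != b -> w Z = 0.

Lemma additive1_0 w t : additive1 w -> w (0 :: t) = 0.
Proof. by move=> wD; apply: (addrI (w (0 :: t))); rewrite -wD !addr0. Qed.

Lemma additive1_N w x t : additive1 w -> w (- x :: t) = - w (x :: t).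
Proof.
by move=> wD; apply: (addrI (w (x :: t))); rewrite -wD !subrr additive1_0.
Qed.

Lemma alt_swap w x y : alternating w -> iota_ x (iota_ y w) = - iota_ y (iota_ x w).
Proof. by case=> ws _; apply/funext => Z; exact: (ws [::]). Qed.

Lemma alt_iota z w : alternating w -> alternating (iota_ z w).
Proof.
move=> [ws wD]; split=> [s x y t|x y t]; first exact: (ws (z :: s)).
by rewrite /iota_ !(ws [::] z)/= wD opprD.
Qed.

Lemma par_iota a z w : parity a w -> parity (~~ a) (iota_ z w).
Proof. by move=> wa Z h; apply: wa => /=; move: h; case: (odd _); case: a. Qed.

Lemma iotaD w z y : alternating w -> iota_ (z + y) w = iota_ z w + iota_ y w.
Proof. by move=> [_ wD]; apply/funext => Z; exact: wD. Qed.

Lemma altD w1 w2 : alternating w1 -> alternating w2 -> alternating (w1 + w2).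
Proof.
move=> [s1 a1] [s2 a2]; split=> [s x y t|x y t]; rewrite !fctE.
  by rewrite s1 s2 opprD.
by rewrite a1 a2 addrACA.
Qed.

Lemma altN w : alternating w -> alternating (- w).
Proof.
move=> [s1 a1]; split=> [s x y t|x y t]; rewrite !fctE; first by rewrite s1.
by rewrite a1 opprD.
Qed.

Lemma alt_sg b w : alternating w -> alternating (sg b w).
Proof. by case: b => //; exact: altN. Qed.
End Forms.

(** * Insertion operators *)

Section Insertion.
Variables (L V : zmodType).
Implicit Types (f g : seq L -> L) (w : seq L -> V).

(** No degree is given: a homogeneous [f] vanishes on blocks of the wrong size, which selects the
    intended shuffles ([insertionE]). *)
Definition ins f w : seq L -> V :=
  split_sum (fun Y Y' => w (f Y :: Y')).
Arguments ins : simpl never.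

Lemma insDl f g w : additive1 w -> ins (f + g) w = ins f w + ins g w.
Proof.
move=> wD; apply/funext => Z; rewrite /ins [RHS]/GRing.add/= -split_sumD.
by apply: eq_split_sum => Y Y' _; exact: wD.
Qed.

Lemma insNl f w : additive1 w -> ins (- f) w = - ins f w.
Proof.
move=> wD; apply/funext => Z; rewrite /ins [RHS]/GRing.opp/= -split_sumN.
by apply: eq_split_sum => Y Y' _; exact: additive1_N.
Qed.

Lemma ins_sgl b f w : additive1 w -> ins (sg b f) w = sg b (ins f w).
Proof. by case: b => //=; exact: insNl. Qed.

Lemma insDr f w1 w2 : ins f (w1 + w2) = ins f w1 + ins f w2.
Proof. by apply/funext => Z; rewrite /ins [RHS]/GRing.add/= -split_sumD. Qed.

Lemma insNr f w : ins f (- w) = - ins f w.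
Proof. by apply/funext => Z; rewrite /ins [RHS]/GRing.opp/= -split_sumN. Qed.

Lemma ins_sgr b f w : ins f (sg b w) = sg b (ins f w).
Proof. by case: b => //=; exact: insNr. Qed.

Lemma ins0l w : additive1 w -> ins 0 w = 0.
Proof.
by move=> wD; apply/funext => Z; apply: split_sum0 => *; exact: additive1_0.
Qed.

(** The head [z] falls into the block of [f] or into the rest. In the second case it crosses that
    block and the value of [f]; blocks of parity other than [a] contribute nothing, so the sign is
    uniform. *)
Lemma iota_ins a z f w : parity a f -> alternating w ->
  iota_ z (ins f w) = ins (iota_ z f) w - sg a (ins f (iota_ z w)).
Proof.
move=> fa [ws wD]; apply/funext => Z; rewrite {1}/iota_ {1}/ins /=.
have ws0 x y t : w [:: x, y & t] = - w [:: y, x & t] := ws [::] x y t.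
have w0 x t : w [:: x, 0 & t] = 0 by rewrite ws0 additive1_0// oppr0.
rewrite -[RHS]/(_ + _); congr (_ + _); rewrite -[RHS]/(- _) sgE.
case: a fa => fa /=; rewrite ?opprK -?split_sumN;
  apply: eq_split_sum => Y Y' _; rewrite ?fctE /iota_;
  case: (boolP (odd (size Y))) => oY /=.
- by rewrite ws0 opprK.
- have -> : f Y = 0 by apply: fa; rewrite (negPf oY).
  by rewrite w0 additive1_0.
- have -> : f Y = 0 by apply: fa; rewrite oY.
  by rewrite w0 additive1_0.
- by rewrite ws0.
Qed.

(** This form makes the antisymmetry in [x] and [y] visible: the last two terms are exchanged up to
    sign. *)
Lemma iota_iota_ins a x y f w : parity a f -> alternating f -> alternating w ->
  iota_ y (iota_ x (ins f w))
  = ins (iota_ y (iota_ x f)) w + ins f (iota_ y (iota_ x w))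
    - sg (~~ a) (ins (iota_ x f) (iota_ y w)) - sg a (ins (iota_ y f) (iota_ x w)).
Proof.
move=> fa fA wA; have wxA := alt_iota x wA.
have fxa := par_iota x fa.
rewrite (iota_ins x fa wA).
rewrite !iotaE (iota_ins y fxa wA) (iota_ins y fa wxA).
by case: a {fa fxa} => /=; zmod.
Qed.

Lemma additive1_ins a f w : parity a f -> alternating f -> alternating w ->
  additive1 (ins f w).
Proof.
move=> fa fA wA x y t.
suff E : iota_ (x + y) (ins f w) = iota_ x (ins f w) + iota_ y (ins f w).
  by rewrite -[LHS]/(iota_ (x + y) (ins f w) t) E.
rewrite !(iota_ins _ fa wA) !iotaD// insDl; last by case: wA.
by rewrite insDr; case: a {fa}; rewrite /=; zmod.
Qed.

(** Skew-symmetry in the first two slots comes from the double contraction. A longer prefix is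
    shortened by contracting its head, which turns [ins f w] into insertions of the same kind. *)
Lemma alt_ins a f w : parity a f -> alternating f -> alternating w ->
  alternating (ins f w).
Proof.
move=> fa fA wA; split; last exact: additive1_ins fa fA wA.
move=> s; elim: s a f w fa fA wA => [|z s IH] a f w fa fA wA x y t.
  have E : iota_ y (iota_ x (ins f w)) = - iota_ x (iota_ y (ins f w)).
    rewrite !(iota_iota_ins _ _ fa fA wA) [iota_ y (iota_ x f)]alt_swap//.
    rewrite [iota_ y (iota_ x w)]alt_swap// insNr insNl; last by case: wA.
    by case: a {fa} => /=; zmod.
  by rewrite -[LHS]/(iota_ y (iota_ x (ins f w)) t) E.
have E u : ins f w (z :: u)
    = ins (iota_ z f) w u - sg a (ins f (iota_ z w) u).
  by rewrite -[LHS]/(iota_ z (ins f w) u) (iota_ins z fa wA) !funE.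
have fza := par_iota z fa; have fzA := alt_iota z fA; have wzA := alt_iota z wA.
rewrite /= !E (IH _ _ _ fza fzA wA) (IH _ _ _ fa fA wzA).
by case: (a) => /=; zmod.
Qed.

Lemma par_ins a b f w : parity a f -> parity b w -> additive1 w ->
  parity (~~ (a (+) b)) (ins f w).
Proof.
move=> fa wb wD Z hZ; apply: split_sum0 => Y Y' e.
have [oY|oY] := eqVneq (odd (size Y)) a; last by rewrite fa// additive1_0.
apply: wb => /=; move: hZ; rewrite -e oddD oY.
by case: (a); case: (odd _); case: (b).
Qed.
End Insertion.

(** * The commutator of two insertions *)

Section NijenhuisRichardson.
Variables (L V : zmodType).
Implicit Types (f g : seq L -> L) (w : seq L -> V).

Let nr a b f g w := ins f (ins g w) - sg (~~ a && ~~ b) (ins g (ins f w))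
  - ins (ins f g) w + sg (~~ a && ~~ b) (ins (ins g f) w).

(** The defect [nr] of the identity is stable under contraction, so it vanishes by induction on the
    arguments. The sign is that of operators of degrees p - 1 and q - 1, for [f] and [g] of degrees
    p and q. *)
Lemma ins_ins a b f g w : parity a f -> parity b g ->
  alternating f -> alternating g -> alternating w ->
  ins f (ins g w) - sg (~~ a && ~~ b) (ins g (ins f w))
  = ins (ins f g) w - sg (~~ a && ~~ b) (ins (ins g f) w).
Proof.
move=> fa gb fA gA wA.
suff E Z : nr a b f g w Z = 0.
  apply/eqP; rewrite -subr_eq0; apply/eqP/funext => Z.
  by rewrite -[RHS](E Z); congr (_ Z); rewrite /nr; zmod.
elim: Z a b f g w fa gb fA gA wA => [|z Z IH] a b f g w fa gb fA gA wA.
  (* On the empty list the terms with one value nested in the other cancel, and those with both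
     values as arguments of [w] cancel by skew-symmetry; odd forms vanish there. *)
  have wD := wA.2.
  rewrite /nr !funE /ins /=.
  have w0 x t : w [:: x, 0 & t] = 0.
    by rewrite (wA.1 [::]) /= additive1_0 ?oppr0.
  case: a b fa gb => [] [] /= fa gb; last by rewrite (wA.1 [::] (f _)) /=; zmod.
  - rewrite (fa [::])// (gb [::])//.
    by rewrite !(w0, additive1_0 _ wD, additive1_0 _ fA.2, additive1_0 _ gA.2); zmod.
  - by rewrite (fa [::])// !(w0, additive1_0 _ wD, additive1_0 _ gA.2); zmod.
  - by rewrite (gb [::])// !(w0, additive1_0 _ wD, additive1_0 _ fA.2); zmod.
have wD := wA.2; have wzA := alt_iota z wA.
have fzA := alt_iota z fA; have gzA := alt_iota z gA.
have fza := par_iota z fa; have gzb := par_iota z gb.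
have gwA := alt_ins gb gA wA; have fwA := alt_ins fa fA wA.
have fga := par_ins fa gb gA.2; have gfa := par_ins gb fa fA.2.
(* The head [z] is contracted in turn into [f], [g] and [w]; each term is a smaller instance of the
   defect. *)
suff -> : nr a b f g w (z :: Z) = nr (~~ a) b (iota_ z f) g w Z
   - sg a (nr a (~~ b) f (iota_ z g) w Z) + sg (a (+) b) (nr a b f g (iota_ z w) Z).
  by rewrite !IH// !sg0 subr0 addr0.
suff E : iota_ z (nr a b f g w) = nr (~~ a) b (iota_ z f) g w
   - sg a (nr a (~~ b) f (iota_ z g) w) + sg (a (+) b) (nr a b f g (iota_ z w)).
  rewrite -[LHS]/(iota_ z (nr a b f g w) Z) E.
  by rewrite !funE.
rewrite /nr.
rewrite !iotaE (iota_ins z fa gwA) (iota_ins z gb fwA) (iota_ins z fga wA).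
rewrite (iota_ins z gfa wA) (iota_ins z fa gA) (iota_ins z gb fA).
rewrite (iota_ins z fa wA) (iota_ins z gb wA).
rewrite !(insDr, insNr, ins_sgr, insDl, insNl, ins_sgl _ _ wD)//.
by clear; case: a; case: b => /=; zmod.
Qed.
End NijenhuisRichardson.

(** * Covariant derivation along a vector-valued form *)

Section Biadditive.
Variables (U V W : zmodType).

Definition biadditive (h : U -> V -> W) :=
  (forall v, {morph h^~ v : x y / x + y}) /\ (forall u, {morph h u : x y / x + y}).

Variable h : U -> V -> W.
Hypothesis hB : biadditive h.

Lemma biadd0l v : h 0 v = 0.
Proof. by apply: (addrI (h 0 v)); rewrite -[LHS](hB.1 v) !addr0. Qed.
Lemma biadd0r u : h u 0 = 0.
Proof. by apply: (addrI (h u 0)); rewrite -(hB.2 u) !addr0. Qed.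
Lemma biaddNl u v : h (- u) v = - h u v.
Proof. by apply: (addrI (h u v)); rewrite -[LHS](hB.1 v) !subrr biadd0l. Qed.
End Biadditive.

Definition one_form (L : Type) (V : zmodType) (g : L -> V) (Y : seq L) : V :=
  if Y is [:: y] then g y else 0.

Definition dot (L V W : Type) (n : L -> V -> W) (f : seq L -> L) (z : V) :=
  fun Y => n (f Y) z.

Section Covariant.
Variables (L V : zmodType) (nL : L -> L -> L) (nV : L -> V -> V).
Hypotheses (nLB : biadditive nL) (nVB : biadditive nV).
Implicit Types (f g : seq L -> L) (w : seq L -> V).

Lemma par_one_form (W : zmodType) (g : L -> W) : parity true (one_form g).
Proof. by case=> [|y []]. Qed.

Lemma alt_one_form (W : zmodType) (g : L -> W) : {morph g : x y / x + y} ->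
  alternating (one_form g).
Proof.
move=> gD; split=> [s x y t|x y [|? ?]] /=; last by rewrite addr0.
  by case: s => [|? []]; rewrite //= oppr0.
exact: gD.
Qed.

Lemma ins_iota_one_form (h : L -> L) z w : additive1 w ->
  ins (iota_ z (one_form h)) w = iota_ (h z) w.
Proof.
move=> wD; apply/funext => Z; rewrite /ins.
by rewrite split_sum_nil// => *; rewrite /iota_/= additive1_0.
Qed.

(** The covariant derivative of a form along [u]: inserting the 1-form [nL u] replaces each argument
    [z] in turn by [nL u z]. *)
Definition cov_der u w : seq L -> V :=
  (fun Z => nV u (w Z)) - ins (one_form (nL u)) w.

Definition D_along f w : seq L -> V :=
  split_sum (fun Y Y' => cov_der (f Y) w Y').
Arguments D_along : simpl never.

Lemma cov_derDl u v w : additive1 w ->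
  cov_der (u + v) w = cov_der u w + cov_der v w.
Proof.
move=> wD; rewrite /cov_der.
have -> : one_form (nL (u + v)) = one_form (nL u) + one_form (nL v).
  apply/funext => Y; rewrite funE; case: Y => [|y [|? ?]] /=; rewrite ?addr0//.
  exact: nLB.1.
rewrite insDl//.
have -> : (fun Z => nV (u + v) (w Z)) = (fun Z => nV u (w Z)) + (fun Z => nV v (w Z)).
  by apply/funext => Z; rewrite funE; exact: nVB.1.
by zmod.
Qed.

Lemma cov_derDr u w1 w2 : cov_der u (w1 + w2) = cov_der u w1 + cov_der u w2.
Proof.
rewrite /cov_der insDr.
have -> : (fun Z => nV u ((w1 + w2) Z))
    = (fun Z => nV u (w1 Z)) + (fun Z => nV u (w2 Z)).
  by apply/funext => Z; rewrite !funE; exact: nVB.2.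
by zmod.
Qed.

Lemma cov_der0l w : additive1 w -> cov_der 0 w = 0.
Proof.
by move=> wD; apply: (addrI (cov_der 0 w)); rewrite -cov_derDl// !addr0.
Qed.

Lemma iota_cov_der z u w : alternating w ->
  iota_ z (cov_der u w) = cov_der u (iota_ z w) - iota_ (nL u z) w.
Proof.
move=> wA; rewrite /cov_der !iotaE.
rewrite (iota_ins z (par_one_form _) wA) ins_iota_one_form /=; last by case: wA.
rewrite (_ : iota_ z (fun Z => nV u (w Z)) = fun Z => nV u (iota_ z w Z))//.
by zmod.
Qed.

Lemma D_alongDl f g w : additive1 w -> D_along (f + g) w = D_along f w + D_along g w.
Proof.
move=> wD; apply/funext => Z; rewrite funE /D_along -split_sumD.
by apply: eq_split_sum => Y Y' _; rewrite !funE cov_derDl.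
Qed.

Lemma D_alongDr f w1 w2 : D_along f (w1 + w2) = D_along f w1 + D_along f w2.
Proof.
apply/funext => Z; rewrite funE /D_along -split_sumD.
by apply: eq_split_sum => Y Y' _; rewrite !funE cov_derDr.
Qed.

Lemma D_along0l w : additive1 w -> D_along 0 w = 0.
Proof.
move=> wD; apply/funext => Z; apply: split_sum0 => Y Y' _.
by rewrite [0 Y]/(0 : L) cov_der0l.
Qed.

Lemma D_alongNl f w : additive1 w -> D_along (- f) w = - D_along f w.
Proof.
by move=> wD; apply: (addrI (D_along f w)); rewrite -D_alongDl// !subrr D_along0l.
Qed.

Lemma D_along0r f : D_along f 0 = 0.
Proof. by apply: (addrI (D_along f 0)); rewrite -D_alongDr !addr0. Qed.

Lemma D_alongNr f w : D_along f (- w) = - D_along f w.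
Proof.
by apply: (addrI (D_along f w)); rewrite -D_alongDr !subrr D_along0r.
Qed.

Lemma D_along_sgl b f w : additive1 w -> D_along (sg b f) w = sg b (D_along f w).
Proof. by case: b => //=; exact: D_alongNl. Qed.

Lemma D_along_sgr b f w : D_along f (sg b w) = sg b (D_along f w).
Proof. by case: b => //=; exact: D_alongNr. Qed.

(** As for [ins], but with no value of [f] to cross. The term with [dot] comes from differentiating
    [z] itself along [f Y]. *)
Lemma iota_D_along a z f w : parity a f -> alternating w ->
  iota_ z (D_along f w) = D_along (iota_ z f) w
    + sg a (D_along f (iota_ z w) - ins (dot nL f z) w).
Proof.
move=> fa wA; apply/funext => Z; rewrite !funE {1}/iota_ {1}/D_along /=.
congr (_ + _); rewrite -split_sumN -split_sumD -split_sum_sg.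
apply: eq_split_sum => Y Y' _; rewrite !funE.
have [->|oY] := eqVneq (odd (size Y)) a.
  by rewrite -[cov_der _ _ _]/(iota_ z _ Y') iota_cov_der.
rewrite fa// !cov_der0l; [|exact: (alt_iota z wA).2|exact: wA.2].
by rewrite /dot fa// biadd0l// additive1_0 ?subr0 ?sg0//; exact: wA.2.
Qed.

Lemma par_dot a f z : parity a f -> parity a (dot nL f z).
Proof. by move=> fa Y oY; rewrite /dot fa// biadd0l. Qed.

Lemma alt_dot f z : alternating f -> alternating (dot nL f z).
Proof.
move=> [fs fD]; split=> [s x y t|x y t]; rewrite /dot.
  by rewrite fs biaddNl.
by rewrite fD; exact: nLB.1.
Qed.

Lemma dotD f x y : dot nL f (x + y) = dot nL f x + dot nL f y.
Proof. by apply/funext => Y; rewrite !funE; exact: nLB.2. Qed.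

Lemma iota_dot x f z : iota_ x (dot nL f z) = dot nL (iota_ x f) z.
Proof. by []. Qed.

Lemma additive1_D_along a f w : parity a f -> alternating f -> alternating w ->
  additive1 (D_along f w).
Proof.
move=> fa fA wA x y t.
suff E : iota_ (x + y) (D_along f w) = iota_ x (D_along f w) + iota_ y (D_along f w).
  by rewrite -[LHS]/(iota_ (x + y) (D_along f w) t) E.
have wD := wA.2.
rewrite !(iota_D_along _ fa wA) !iotaD// D_alongDl// dotD insDl// D_alongDr.
by case: a {fa} => /=; zmod.
Qed.

Lemma iota_iota_D_along a x y f w : parity a f -> alternating f -> alternating w ->
  iota_ y (iota_ x (D_along f w))
  = D_along (iota_ y (iota_ x f)) w + D_along f (iota_ y (iota_ x w))
    + sg (~~ a) (D_along (iota_ x f) (iota_ y w))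
    + sg a (D_along (iota_ y f) (iota_ x w))
    - sg (~~ a) (ins (dot nL (iota_ x f) y) w) - sg a (ins (dot nL (iota_ y f) x) w)
    - ins (dot nL f y) (iota_ x w) + ins (dot nL f x) (iota_ y w).
Proof.
move=> fa fA wA; have wxA := alt_iota x wA; have fxa := par_iota x fa.
rewrite (iota_D_along x fa wA) !iotaE (iota_D_along y fxa wA) (iota_D_along y fa wxA).
rewrite (iota_ins y (par_dot x fa) wA) iota_dot.
by case: a {fa fxa} => /=; zmod.
Qed.

(** Same induction on the prefix as for [alt_ins]; the extra insertion of [dot nL f z] is
    alternating already. *)
Lemma alt_D_along a f w : parity a f -> alternating f -> alternating w ->
  alternating (D_along f w).
Proof.
move=> fa fA wA; split; last exact: additive1_D_along fa fA wA.
move=> s; elim: s a f w fa fA wA => [|z s IH] a f w fa fA wA x y t.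
  have E : iota_ y (iota_ x (D_along f w)) = - iota_ x (iota_ y (D_along f w)).
    have wD := wA.2.
    rewrite !(iota_iota_D_along _ _ fa fA wA) [iota_ y (iota_ x f)]alt_swap//.
    rewrite [iota_ y (iota_ x w)]alt_swap// D_alongNr D_alongNl//.
    by case: a {fa} => /=; zmod.
  by rewrite -[LHS]/(iota_ y (iota_ x (D_along f w)) t) E.
have E u : D_along f w (z :: u) = D_along (iota_ z f) w u
    + sg a (D_along f (iota_ z w) u - ins (dot nL f z) w u).
  by rewrite -[LHS]/(iota_ z (D_along f w) u) (iota_D_along z fa wA) !funE.
have fza := par_iota z fa; have fzA := alt_iota z fA; have wzA := alt_iota z wA.
rewrite /= !E (IH _ _ _ fza fzA wA) (IH _ _ _ fa fA wzA).
rewrite ((alt_ins (par_dot z fa) (alt_dot z fA) wA).1 s).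
by case: (a) => /=; zmod.
Qed.

Lemma par_D_along a b f w : parity a f -> parity b w -> additive1 w ->
  parity (a (+) b) (D_along f w).
Proof.
move=> fa wb wD Z hZ; apply: split_sum0 => Y Y' e.
have [oY|oY] := eqVneq (odd (size Y)) a; last by rewrite fa// cov_der0l.
have oY' : odd (size Y') != b.
  by move: hZ; rewrite -e oddD oY; case: (a); case: (odd _); case: (b).
rewrite /cov_der !funE wb// biadd0r// add0r.
rewrite (par_ins (par_one_form (nL (f Y))) wb wD) ?oppr0//.
by move: oY'; case: (odd _); case: (b).
Qed.
End Covariant.
Arguments D_along : simpl never.

(** The commutator of an insertion with [D_along] of the identity 1-form, which is the covariant
    exterior derivative when the torsion vanishes ([d_nablaE]). *)
Definition lie_der (L V : zmodType) (nL : L -> L -> L) (nV : L -> V -> V) (a : bool)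
    (f : seq L -> L) (w : seq L -> V) : seq L -> V :=
  ins f (D_along nL nV (one_form id) w) + sg a (D_along nL nV (one_form id) (ins f w)).

(** * The commutator of a covariant derivation and an insertion *)

Section Commutator.
Variables (L V : zmodType) (nL : L -> L -> L) (nV : L -> V -> V).
Hypotheses (nLB : biadditive nL) (nVB : biadditive nV).
Implicit Types (f g : seq L -> L) (w : seq L -> V).
Notation DL := (D_along nL nL).
Notation DV := (D_along nL nV).

Let di a b f g w := DV f (ins g w) - sg (a && ~~ b) (ins g (DV f w))
  - ins (DL f g) w + sg (a && ~~ b) (DV (ins g f) w).

(** The defect [di] is stable under contraction, because the insertions of [dot] that appear are
    reordered by [ins_ins]. Every term differentiates just once, so no curvature arises. *)
Lemma D_along_ins a b f g w : parity a f -> parity b g ->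
  alternating f -> alternating g -> alternating w ->
  DV f (ins g w) - sg (a && ~~ b) (ins g (DV f w))
  = ins (DL f g) w - sg (a && ~~ b) (DV (ins g f) w).
Proof.
move=> fa gb fA gA wA.
suff E Z : di a b f g w Z = 0.
  apply/eqP; rewrite -subr_eq0; apply/eqP/funext => Z.
  by rewrite -[RHS](E Z); congr (_ Z); rewrite /di; zmod.
elim: Z a b f g w fa gb fA gA wA => [|z Z IH] a b f g w fa gb fA gA wA.
  have wD := wA.2; have gwD := additive1_ins gb gA wA.
  have fD := fA.2; have gD := gA.2.
  have cov_nil (W : zmodType) (nW : L -> W -> W) u (v : seq L -> W) : additive1 v ->
      cov_der nL nW u v [::] = nW u (v [::]).
    by move=> vD; rewrite /cov_der !funE /ins /= additive1_0// subr0.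
  have D_nil (W : zmodType) (nW : L -> W -> W) h (v : seq L -> W) :
      D_along nL nW h v [::] = cov_der nL nW (h [::]) v [::] by [].
  have ins_nil (W : zmodType) h (v : seq L -> W) : ins h v [::] = v [:: h [::]] by [].
  have ins1 h u : ins h w [:: u] = w [:: h [:: u]] + w [:: h [::]; u] by [].
  have D1 u : DV f w [:: u] = nV (f [:: u]) (w [::])
      + (nV (f [::]) (w [:: u]) - w [:: nL (f [::]) u]).
    rewrite -[LHS]/(cov_der _ _ _ _ _ + cov_der _ _ _ _ _) cov_nil//.
    by rewrite /cov_der !funE ins1 /= additive1_0// addr0.
  rewrite /di !funE !(D_nil, ins_nil) !cov_nil// !ins_nil D1.
  case: a fa => fa; last by rewrite /=; zmod.
  rewrite (fa [::])// (biadd0l nVB) (biadd0l nLB) additive1_0//.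
  by case: (b) => /=; zmod.
have wD := wA.2; have wzA := alt_iota z wA.
have fzA := alt_iota z fA; have gzA := alt_iota z gA.
have fza := par_iota z fa; have gzb := par_iota z gb.
have gwA := alt_ins gb gA wA; have fwA := alt_D_along nLB nVB fa fA wA.
have fga := par_D_along nLB nLB fa gb gA.2; have gfa := par_ins gb fa fA.2.
have dA := alt_dot nLB z fA; have da := par_dot nLB z fa.
suff -> : di a b f g w (z :: Z) = di (~~ a) b (iota_ z f) g w Z
   + sg a (di a (~~ b) f (iota_ z g) w Z) - sg (a (+) b) (di a b f g (iota_ z w) Z).
  by rewrite !IH// !sg0 subr0 addr0.
suff E : iota_ z (di a b f g w) = di (~~ a) b (iota_ z f) g w
   + sg a (di a (~~ b) f (iota_ z g) w) - sg (a (+) b) (di a b f g (iota_ z w)).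
  rewrite -[LHS]/(iota_ z (di a b f g w) Z) E.
  by rewrite !funE.
rewrite /di.
rewrite !iotaE (iota_D_along nLB nVB z fa gwA) (iota_ins z gb fwA) (iota_ins z fga wA).
rewrite (iota_D_along nLB nVB z gfa wA) (iota_D_along nLB nLB z fa gA).
rewrite (iota_ins z gb fA).
rewrite (iota_D_along nLB nVB z fa wA) (iota_ins z gb wA).
(* [nL] is additive in its first slot, hence passes through the splitting sum. *)
have -> : dot nL (ins g f) z = ins g (dot nL f z).
  apply/funext => Y; rewrite /dot /ins; apply: (@split_sum_morph _ _ _ (nL^~ z)).
  exact: nLB.1.
(* This brings the insertions of [dot nL f z] and of [g] into a common order. *)
have /eqP := ins_ins da gb dA gA wA; rewrite subr_eq => /eqP ->.
rewrite !(insDr, insNr, ins_sgr, insDl, insNl, ins_sgl _ _ wD)//.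
rewrite !(D_alongDr, D_alongNr, D_along_sgr, D_alongDl, D_alongNl, D_along_sgl)//.
by clear; case: a; case: b => /=; zmod.
Qed.

Local Notation id1 := (one_form (@id L)).

Lemma alt_id1 : alternating id1.
Proof. exact: alt_one_form. Qed.

Lemma ins_id1 f : ins f id1 = f.
Proof. by apply/funext => Z; rewrite /ins split_sum_whole. Qed.

Lemma D_along_iota_id1 z w : additive1 w -> DV (iota_ z id1) w = cov_der nL nV z w.
Proof.
move=> wD; apply/funext => Z; rewrite /D_along split_sum_nil// => y Y Y'.
by rewrite /iota_/= cov_der0l.
Qed.

(** The case of [D_along_ins] where the derivation is along the identity 1-form: inserting [f] into
    that form returns [f]. *)
Lemma lie_der_D_along a f w : parity a f -> alternating f -> alternating w ->
  lie_der nL nV a f w = DV f w + sg a (ins (DL id1 f) w).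
Proof.
move=> fa fA wA.
rewrite /lie_der; have := D_along_ins (par_one_form id) fa alt_id1 fA wA.
rewrite ins_id1 => /eqP; rewrite subr_eq => /eqP ->.
by case: a {fa} => /=; zmod.
Qed.

(** The bracket is the antisymmetrised connection, so the bracket terms supply the terms of
    [cov_der] in which an argument is differentiated. Both sides are contracted with the head and
    compared by induction. *)
Lemma d_split_sum (br : L -> L -> L) w : (forall x y, nL x y - nL y x = br x y) ->
  alternating w -> forall Z,
  split_sum (fun Y Y' => if size Y == 1 then nV Y`_0 (w Y') else 0) Z
  - split_sum (fun Y Y' => if size Y == 2 then w (br Y`_0 Y`_1 :: Y') else 0) Z
  = DV id1 w Z.
Proof.
move=> brE wA Z; elim: Z w wA => [|z Z IH] w wA.
  have wD := wA.2.
  by rewrite /= /D_along /= cov_der0l// subr0.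
have wD := wA.2; have wzA := alt_iota z wA.
rewrite -[RHS]/(iota_ z (DV id1 w) Z).
rewrite (iota_D_along nLB nVB z (par_one_form id) wA) !funE -IH//=.
rewrite D_along_iota_id1// /cov_der !funE.
(* In [s1] and [s3] the head [z] lies in the first block, in [s2] and [s4] in the second; [s5] and
   [s6] are the two sums for [iota_ z w]. Torsion-freeness enters through [s3], where [z] is
   bracketed with another argument. *)
set s1 := split_sum _ Z; set s2 := split_sum _ Z.
set s3 := split_sum _ Z; set s4 := split_sum _ Z.
set s5 := split_sum _ Z; set s6 := split_sum _ Z.
have -> : s1 = nV z (w Z) by rewrite /s1 split_sum_nil.
have -> : s2 = - s5.
  rewrite /s2 /s5 -split_sumN; apply: eq_split_sum => Y Y' _; rewrite !funE.
  by case: Y => [|y [|? ?]] //=; rewrite ?oppr0//; case: (~~ _); rewrite /= ?oppr0.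
have -> : s4 = - s6.
  rewrite /s4 /s6 -split_sumN; apply: eq_split_sum => Y Y' _; rewrite !funE.
  case: Y => [|x [|y [|? ?]]] //=; rewrite ?oppr0//; last first.
    by case: (~~ _); rewrite /= ?oppr0.
  by rewrite (wA.1 [::]).
have -> : s3 = ins (one_form (nL z)) w Z - ins (dot nL id1 z) w Z.
  rewrite -fun_oppE -fun_addE -insNl// -insDl//.
  apply: eq_split_sum => Y Y' _; rewrite !funE /dot.
  case: Y => [|y [|? ?]] /=; rewrite ?(biadd0l nLB) ?subrr ?additive1_0//.
  by rewrite -brE.
by zmod.
Qed.
End Commutator.

(** * The commutator of a Lie derivative and an insertion *)

Section LieDerivative.
Variables (L V : zmodType) (nL : L -> L -> L) (nV : L -> V -> V).
Hypotheses (nLB : biadditive nL) (nVB : biadditive nV).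
Implicit Types (f g : seq L -> L) (w : seq L -> V).
Notation DL := (D_along nL nL).
Notation DV := (D_along nL nV).
Local Notation id1 := (one_form (@id L)).

(** With the Lie derivative written as a derivation plus an insertion ([lie_der_D_along]), the two
    known commutators add up to the identity that defines the bracket. *)
Lemma lie_der_ins a b f g w : parity a f -> parity b g ->
  alternating f -> alternating g -> alternating w ->
  lie_der nL nV a f (ins g w) - sg (a && ~~ b) (ins g (lie_der nL nV a f w))
  = ins (lie_der nL nL a f g - sg (a && b) (lie_der nL nL b g f)) w
    - sg (a && ~~ b) (lie_der nL nV (~~ (a (+) b)) (ins g f) w).
Proof.
move=> fa gb fA gA wA.
have gwA := alt_ins gb gA wA; have fwA := alt_ins fa fA wA.
have gfA := alt_ins gb gA fA; have gfa := par_ins gb fa fA.2.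
have idA := alt_id1 L; have idp := par_one_form (@id L).
have dfA := alt_D_along nLB nLB idp idA fA.
have dfp := par_D_along nLB nLB idp fa fA.2.
rewrite (lie_der_D_along nLB nVB fa fA gwA) (lie_der_D_along nLB nVB fa fA wA).
rewrite addbC in gfa; rewrite (lie_der_D_along nLB nVB gfa gfA wA).
(* The Lie derivative of [f] along [g] is unfolded instead: its two terms are those produced by
   [ins_ins] and by the Lie derivative along [ins g f]. *)
rewrite (lie_der_D_along nLB nLB fa fA gA) {1}/lie_der.
have wD := wA.2.
rewrite !(insDr, insNr, ins_sgr, insDl, insNl, ins_sgl _ _ wD)//.
have /eqP := D_along_ins nLB nVB fa gb fA gA wA; rewrite subr_eq => /eqP ->.
have /eqP := ins_ins dfp gb dfA gA wA; rewrite subr_eq => /eqP ->.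
by clear; case: a; case: b => /=; zmod.
Qed.
End LieDerivative.

(** * Linearity over functions *)

Section ScalarLinear.
Variables (C : comPzRingType) (L : lmodType C).

Definition scalar1 (V : lmodType C) (w : seq L -> V) :=
  forall (c : C) x t, w (c *: x :: t) = c *: w (x :: t).

Lemma split_sumZ (V : lmodType C) c (F : seq L -> seq L -> V) Z :
  split_sum (fun Y Y' => c *: F Y Y') Z = c *: split_sum F Z.
Proof. by rewrite (split_sum_morph F Z (scalerDr c)). Qed.

Lemma sgZ (V : lmodType C) b c (v : V) : sg b (c *: v) = c *: sg b v.
Proof. by case: b; rewrite //= scalerN. Qed.

Section OneBundle.
Variable V : lmodType C.
Implicit Types (f : seq L -> L) (w : seq L -> V).

Lemma scalar1_iota z w : alternating w -> scalar1 w -> scalar1 (iota_ z w).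
Proof.
by move=> [ws _] wZ c x t; rewrite /iota_ !(ws [::] z)/= wZ scalerN.
Qed.

Lemma scalar1D w1 w2 : scalar1 w1 -> scalar1 w2 -> scalar1 (w1 + w2).
Proof. by move=> h1 h2 c x t; rewrite !funE h1 h2 scalerDr. Qed.

Lemma scalar1N w : scalar1 w -> scalar1 (- w).
Proof. by move=> h c x t; rewrite !funE h scalerN. Qed.

Lemma scalar1_sg b w : scalar1 w -> scalar1 (sg b w).
Proof. by case: b => //; exact: scalar1N. Qed.

Lemma insZ c f w Z : scalar1 w -> ins (fun Y => c *: f Y) w Z = c *: ins f w Z.
Proof.
move=> wZ; rewrite /ins -split_sumZ.
by apply: eq_split_sum => Y Y' _; exact: wZ.
Qed.

Lemma scalar1_ins a f w : parity a f -> alternating w ->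
  scalar1 f -> scalar1 w -> scalar1 (ins f w).
Proof.
move=> fa wA fZ wZ c x t.
have E z : ins f w (z :: t) = ins (iota_ z f) w t - sg a (ins f (iota_ z w) t).
  by rewrite -[LHS]/(iota_ z (ins f w) t) (iota_ins z fa wA) !funE.
rewrite !E scalerBr -sgZ; congr (_ - sg _ _).
  have -> : iota_ (c *: x) f = fun Y => c *: iota_ x f Y.
    by apply/funext => Y; exact: fZ.
  exact: insZ.
by rewrite /ins -split_sumZ; apply: eq_split_sum => Y Y' _; exact: wZ.
Qed.
End OneBundle.

Variables (V : lmodType C) (r : L -> C -> C).
Variables (nL : L -> L -> L) (nV : L -> V -> V).
Hypotheses (nLB : biadditive nL) (nVB : biadditive nV).
Hypotheses (nLZ : forall c x y, nL (c *: x) y = c *: nL x y).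
Hypotheses (nVZ : forall c x y, nV (c *: x) y = c *: nV x y).
Hypotheses (nLr : forall c x y, nL x (c *: y) = r x c *: y + c *: nL x y).
Hypotheses (nVr : forall c x y, nV x (c *: y) = r x c *: y + c *: nV x y).
Implicit Types (f : seq L -> L) (w : seq L -> V).

Lemma cov_derZl c u w Z : scalar1 w ->
  cov_der nL nV (c *: u) w Z = c *: cov_der nL nV u w Z.
Proof.
move=> wZ; rewrite /cov_der !funE nVZ scalerBr -insZ//.
suff -> : one_form (nL (c *: u)) = fun Y => c *: one_form (nL u) Y by [].
by apply/funext => -[|y [|? ?]] /=; rewrite ?scaler0.
Qed.

Lemma cov_derZr c u w Z :
  cov_der nL nV u (fun Y => c *: w Y) Z = r u c *: w Z + c *: cov_der nL nV u w Z.
Proof.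
by rewrite /cov_der !funE nVr scalerBr -addrA -split_sumZ.
Qed.

(** A factor [c] of the contracted argument is differentiated in the form and again in [dot]; the
    two terms with [r (f Y) c] cancel. *)
Lemma scalar1_D_along a f w : parity a f -> alternating w ->
  scalar1 f -> scalar1 w -> scalar1 (D_along nL nV f w).
Proof.
move=> fa wA fZ wZ c x t.
have E z : D_along nL nV f w (z :: t) = D_along nL nV (iota_ z f) w t
    + sg a (D_along nL nV f (iota_ z w) t - ins (dot nL f z) w t).
  by rewrite -[LHS]/(iota_ z (D_along _ _ f w) t) (iota_D_along nLB nVB z fa wA) !funE.
rewrite !E scalerDr -sgZ; congr (_ + sg _ _).
  rewrite /D_along -split_sumZ; apply: eq_split_sum => Y Y' _.
  by rewrite /iota_ fZ cov_derZl.
rewrite scalerBr /D_along /ins -!split_sumZ -!split_sumN -!split_sumD.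
apply: eq_split_sum => Y Y' _; rewrite !funE /dot.
have -> : iota_ (c *: x) w = fun Z => c *: iota_ x w Z.
  by apply/funext => Z; exact: wZ.
by rewrite cov_derZr nLr wA.2 !wZ {1}/iota_; zmod.
Qed.
End ScalarLinear.

(** * Shuffles as splittings *)

Section ShufflePerm.
Variable n : nat.

Lemma lift_perm_surj (i0 : 'I_n.+1) (s : 'S_n.+1) :
  exists s' : 'S_n, s = lift_perm i0 (s i0) s'.
Proof.
pose f (k : 'I_n) : 'I_n := odflt k (unlift (s i0) (s (lift i0 k))).
have fK k : lift (s i0) (f k) = s (lift i0 k).
  have := neq_lift i0 k; rewrite /f -(inj_eq (@perm_inj _ s)).
  by move=> /unlift_some[m -> ->].
have f_inj : injective f.
  by move=> k m /(congr1 (lift (s i0))); rewrite !fK => /perm_inj /lift_inj.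
exists (perm f_inj); apply/permP => k.
by have [m|] := unliftP i0 k => ->; rewrite ?lift_perm_id// lift_perm_lift permE fK.
Qed.

Lemma sum_perm_lift (V : zmodType) (i0 j0 : 'I_n.+1) (P : pred 'S_n.+1)
    (G : 'S_n.+1 -> V) :
  \sum_(s | P s && (s i0 == j0)) G s
  = \sum_(s : 'S_n | P (lift_perm i0 j0 s)) G (lift_perm i0 j0 s).
Proof.
pose g (s : 'S_n.+1) := sval (cid (lift_perm_surj i0 s)).
have gK (s : 'S_n.+1) : s = lift_perm i0 (s i0) (g s) :=
  svalP (cid (lift_perm_surj i0 s)).
rewrite (reindex (lift_perm i0 j0)) /=.
  by apply: eq_bigl => s; rewrite lift_perm_id eqxx andbT.
exists g => [s _|s /andP[_ /eqP <-]]; last by rewrite -gK.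
apply/permP => k; apply: (@lift_inj _ j0); rewrite -!(lift_perm_lift i0 j0).
by rewrite -{1}(lift_perm_id i0 j0 s) -gK.
Qed.
End ShufflePerm.

Definition shuf (n k : nat) (s : 'S_n) := [forall i : 'I_n, forall j : 'I_n,
  (i < j)%N && ((j < k)%N || (k <= i)%N) ==> (s i < s j)%N].

Lemma shufP n k (s : 'S_n) : reflect
  (forall i j : 'I_n, (i < j)%N -> (j < k)%N || (k <= i)%N -> (s i < s j)%N)
  (shuf k s).
Proof.
apply: (iffP forallP) => h i; last first.
  by apply/forallP => j; apply/implyP => /andP[]; exact: h.
by move=> j ij jk; have /forallP/(_ j) := h i; rewrite ij jk.
Qed.

(** The least value heads one of the two blocks. Removing it leaves a shuffle, whose first block is
    one shorter exactly when the value was there. *)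
Lemma shuf_lift n k (i0 : 'I_n.+1) k' (s : 'S_n) :
  (i0 = 0%N :> nat /\ k' = k.+1) \/ (i0 = k :> nat /\ k' = k) ->
  shuf k' (lift_perm i0 ord0 s) = shuf k s.
Proof.
move=> h; apply/shufP/shufP => sP i j ij jk; last first.
  have := ij; have := jk.
  have [i' ->|->] := unliftP i0 i; have [j' ->|->] := unliftP i0 j;
    rewrite ?lift_perm_lift ?lift_perm_id ?lift0//=.
  - rewrite /bump => jk' ij'; rewrite ltnS; apply: sP; lia.
  - rewrite /bump /=; lia.
  - lia.
have := sP (lift i0 i) (lift i0 j); rewrite !lift_perm_lift !lift0 ltnS; apply;
  rewrite /= /bump; lia.
Qed.

Definition perm_seq (T : zmodType) n (Z : seq T) (s : 'S_n) : seq T :=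
  [seq Z`_(s i) | i <- enum 'I_n].

Lemma size_perm_seq (T : zmodType) n (Z : seq T) (s : 'S_n) : size (perm_seq Z s) = n.
Proof. by rewrite size_map size_enum_ord. Qed.

Lemma nth_perm_seq (T : zmodType) n (Z : seq T) (s : 'S_n) (i : 'I_n) :
  (perm_seq Z s)`_i = Z`_(s i).
Proof. by rewrite (nth_map i) ?size_enum_ord// nth_ord_enum. Qed.

Lemma perm_seq_lift (T : zmodType) n z (Z : seq T) (i0 : 'I_n.+1) (s : 'S_n) :
  perm_seq (z :: Z) (lift_perm i0 ord0 s)
  = take i0 (perm_seq Z s) ++ z :: drop i0 (perm_seq Z s).
Proof.
have i0n : (i0 <= n)%N by rewrite -ltnS.
have st : size (take i0 (perm_seq Z s)) = i0.
  by rewrite size_takel// size_perm_seq.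
apply: (@eq_from_nth _ 0) => [|m].
  by rewrite size_cat /= st size_drop !size_perm_seq addnS subnKC.
rewrite size_perm_seq => mn; rewrite -[m]/(nat_of_ord (Ordinal mn)) nth_perm_seq.
rewrite nth_cat st /=; have [k|] := unliftP i0 (Ordinal mn); move=> e.
  have em : m = bump i0 k by rewrite -[m]/(nat_of_ord (Ordinal mn)) e.
  rewrite e lift_perm_lift lift0 /= -nth_perm_seq em /bump.
  have [i0k|ki0] := leqP i0 k; rewrite /= ?add0n ?add1n.
    by rewrite ltnNge ltnW// subSn//= nth_drop subnKC.
  by rewrite ki0 nth_take.
have em : m = i0 by rewrite -[m]/(nat_of_ord (Ordinal mn)) e.
by rewrite e lift_perm_id em ltnn subnn.
Qed.

(** Induction following the recursion of [split_sum]: the least index is taken at the head of a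
    block, in the first block ([eqA]) or in the second ([eqB]), where its removal costs the sign of
    crossing [k] arguments. *)
Lemma sum_shuf (T V : zmodType) n k (F : seq T -> seq T -> V) (Z : seq T) :
  size Z = n -> (k <= n)%N ->
  \sum_(s : 'S_n | shuf k s)
     F (take k (perm_seq Z s)) (drop k (perm_seq Z s)) *~ (-1) ^+ s
  = split_sum (fun Y Y' => if size Y == k then F Y Y' else 0) Z.
Proof.
elim: Z n k F => [|z Z IH] n k F <- /=.
  rewrite leqn0 => /eqP->; rewrite (big_pred1 1%g) => [|s /=].
    by rewrite odd_perm1 mulr1z /perm_seq /= (size0nil (size_enum_ord 0)).
  by rewrite (_ : s = 1%g) ?eqxx; [apply/shufP => -[]|apply/permP => -[]].
move=> kn.
have eqA j : k = j.+1 -> \sum_(s : 'S_(size Z).+1 | shuf k s && (s ord0 == ord0))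
     F (take k (perm_seq (z :: Z) s)) (drop k (perm_seq (z :: Z) s)) *~ (-1) ^+ s
    = split_sum (fun Y Y' => if (size Y).+1 == k then F (z :: Y) Y' else 0) Z.
  move=> kj; rewrite sum_perm_lift kj -(IH (size Z))//; last by rewrite -ltnS -kj.
  apply: eq_big => s; first by apply: shuf_lift; left.
  by move=> _; rewrite perm_seq_lift take0 drop0 odd_lift_perm.
have eqB (i : 'I_(size Z).+1) : k = i :> nat ->
    \sum_(s : 'S_(size Z).+1 | shuf k s && (s i == ord0))
     F (take k (perm_seq (z :: Z) s)) (drop k (perm_seq (z :: Z) s)) *~ (-1) ^+ s
    = split_sum (fun Y Y' => sg (odd (size Y))
        (if size Y == k then F Y (z :: Y') else 0)) Z.
  move=> ki; have kZ : (k <= size Z)%N by rewrite ki -ltnS.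
  rewrite sum_perm_lift.
  rewrite (@eq_split_sum _ _ _ (fun Y Y' =>
     if size Y == k then sg (odd k) (F Y (z :: Y')) else 0)); last first.
    by move=> Y Y' _; case: eqP => [->//|]; rewrite sg0.
  rewrite -(IH (size Z))//; apply: eq_big => s; first by apply: shuf_lift; right.
  move=> _; rewrite perm_seq_lift -ki.
  have st : size (take k (perm_seq Z s)) = k by rewrite size_takel// size_perm_seq.
  rewrite take_size_cat// drop_size_cat// odd_lift_perm /= addbF -ki.
  by case: (odd k) => //=; case: (odd_perm s);
    rewrite /= ?mulrNz ?mulNrz ?opprK ?mulr1z.
have s0 (s : 'S_(size Z).+1) i : shuf k s -> s i = ord0 -> i = ord0 \/ i = k :> nat.
  move=> /shufP sP si0.
  suff: (i == 0%N :> nat) || (i == k :> nat).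
    by case/orP => /eqP; [left; exact: val_inj|right].
  apply: contra_eqT si0; rewrite negb_or => /andP[i0 ik].
  have [ki|ki] := leqP k i.
    have hk : (k < (size Z).+1)%N by apply: leq_ltn_trans ki (ltn_ord i).
    have := sP (Ordinal hk) i; rewrite /= leqnn orbT ltn_neqAle eq_sym ik ki.
    by move=> /(_ isT isT); case: (s i) => -[].
  have := sP ord0 i; rewrite /= lt0n i0 ki => /(_ isT isT).
  by case: (s i) => -[].
have sE (s : 'S_(size Z).+1) j : (s j == ord0) = (j == s^-1%g ord0).
  by rewrite -[RHS](inj_eq (@perm_inj _ s)) permKV.
(* For [k = 0] the two head positions coincide, and only the second block exists. *)
have [k0|k0] := posnP k.
  rewrite [X in _ = X + _]split_sum0 ?add0r => [|Y Y' _]; last by rewrite k0.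
  rewrite -(eqB ord0)//; apply: eq_bigl => s; rewrite sE.
  have [sP|//] := boolP (shuf k s); rewrite -val_eqE.
  by have [|->|e] := s0 s (s^-1%g ord0) sP; rewrite ?permKV//= e k0.
rewrite -(eqA k.-1) ?prednK// (bigID (fun s : 'S_(size Z).+1 => s ord0 == ord0)) /=.
congr (_ + _); have [kZ|kZ] := leqP k (size Z).
  rewrite -(eqB (Ordinal (kZ : (k < (size Z).+1)%N)))//; apply: eq_bigl => s.
  have [sP|//] := boolP (shuf k s); rewrite !sE -!val_eqE /=.
  by have [|->|e] := s0 s (s^-1%g ord0) sP; rewrite ?permKV//= ?e; lia.
(* Here [k] is the whole length, so there is no second block. *)
rewrite split_sum0 => [|Y Y' e]; last first.
  by case: eqP => [Yk|_]; rewrite ?sg0//; move: kZ; rewrite -e Yk; lia.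
apply: big_pred0 => s; have [sP|//] := boolP (shuf k s); rewrite sE -val_eqE /=.
have [|->//|e] := s0 s (s^-1%g ord0) sP; rewrite ?permKV//.
by have := ltn_ord (s^-1%g ord0); rewrite e; lia.
Qed.

Lemma shuffle_sumE (R : realType) (M : smoothManifold R) (A : lieAlgebroid M)
    (V : zmodType) k (F : seq (Gamma A) -> seq (Gamma A) -> V) Z :
  shuffle_sum k F Z = split_sum (fun Y Y' => if size Y == k then F Y Y' else 0) Z.
Proof.
rewrite /shuffle_sum; case: leqP => kZ; last first.
  rewrite split_sum0// => Y Y' e; case: eqP => // Yk.
  by move: kZ; rewrite -e Yk -ltn_subRL subnn.
rewrite -(@sum_shuf _ _ _ k F Z erefl kZ) /Sh.
under eq_bigl do rewrite inE.
(* Generalising [k + (size Z - k)] allows the type of the permutations to be rewritten to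
   ['S_(size Z)]. *)
by rewrite /shuf /perm_seq; move: (k + _)%N (subnKC kZ) => m ->.
Qed.

(** * Cut-off functions *)

Section Flat.
Variable R : realType.

(** The factor [t^-1 ^+ n] makes the family closed under differentiation, up to linear combinations
    ([is_derive_flat]). *)
Definition flat (n : nat) (t : R) : R := if 0 < t then t^-1 ^+ n * expR (- t^-1) else 0.

Lemma flat_ge0 n t : 0 <= flat n t.
Proof.
rewrite /flat; case: ifPn => // t0.
by rewrite mulr_ge0 ?exprn_ge0 ?invr_ge0 ?expR_ge0// ltW.
Qed.

Lemma flat_gt0 n t : 0 < t -> 0 < flat n t.
Proof.
by move=> t0; rewrite /flat t0 mulr_gt0 ?exprn_gt0 ?invr_gt0 ?expR_gt0.
Qed.

Lemma flat_le0 n t : t <= 0 -> flat n t = 0.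
Proof. by rewrite /flat leNgt => /negbTE->. Qed.

(** The exponential of [t^-1] dominates its Taylor term of degree [n.+2]. The quadratic bound gives
    derivative 0 at the origin. *)
Lemma flat_bound n t : `|flat n t| <= n.+2`!%:R * t ^+ 2.
Proof.
rewrite ger0_norm ?flat_ge0//.
have [t0|t0] := ltP 0 t; last by rewrite flat_le0// mulr_ge0 ?sqr_ge0.
have s0 : 0 < t^-1 by rewrite invr_gt0.
have := expR_ge1Dxn n.+1 (ltW s0); rewrite /flat t0 expRN => h.
rewrite ler_pdivrMr ?expR_gt0// mulrAC -ler_pdivrMr ?exprn_gt0//.
rewrite -exprVn -exprD addn2 -ler_pdivrMl; last by rewrite ltr0n fact_gt0.
rewrite mulrC; apply: le_trans h; rewrite lerDr//.
Qed.

Lemma is_derive_flat n (t : R) :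
  is_derive t 1 (flat n) (- n%:R * flat n.+1 t + flat n.+2 t).
Proof.
have [t0|t0|->] := ltgtP t 0.
- rewrite !flat_le0 ?ltW// mulr0 addr0.
  apply: (@near_eq_is_derive _ _ _ (cst 0)).
  by near=> u; rewrite flat_le0//; apply: ltW; near: u; exact: lt_nbhsl.
- have -> : - n%:R * flat n.+1 t + flat n.+2 t =
     (n%:R * t^-1 ^+ n.-1 * expR (- t^-1) + t^-1 ^+ n * (- expR (- t^-1))) * (- t ^- 2).
    rewrite /flat t0 -exprVn; case: n => [|n] /=; rewrite ?exprS; ring.
  have dV : is_derive t 1 (fun u => u^-1) (- t ^- 2).
    have := @is_deriveV _ id t _ 1 (lt0r_neq0 t0) (is_derive_id _ _).
    by rewrite /GRing.scale/= mulr1.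
  have dE : is_derive t^-1 1 (expR \o -%R) (expR (- t^-1) * -1).
    by apply: is_derive1_comp; exact: is_derive_id.
  have dX : is_derive t^-1 1 (id ^+ n) (n%:R * t^-1 ^+ n.-1 *: 1) by exact: is_deriveX.
  have dM := is_deriveM dX dE.
  have dC := is_derive1_comp dM dV.
  have pX x : ((id : R -> R) ^+ n) x = x ^+ n by rewrite exprfctE.
  apply: (near_eq_is_derive _ (is_derive_eq dC _)).
    near=> u; rewrite /flat ifT//=; last by near: u; exact: lt_nbhsr.
    by rewrite -[LHS]/(_ * _) pX.
  by rewrite pX /GRing.scale/=; ring.
- rewrite !flat_le0// mulr0 addr0.
  (* By [flat_bound] the difference quotient at 0 is at most a constant times [|h|]. *)
  have g0 : h^-1 *: ((flat n \o shift 0) (h *: 1) - flat n 0) @[h --> 0^'] --> 0.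
    apply/cvgr0Pnorm_lt => e e0; near=> h.
    rewrite /= addr0 (flat_le0 n (lexx 0)) subr0.
    rewrite /GRing.scale/= mulr1 normrM normfV ltr_pdivrMl; last first.
      by rewrite normr_gt0; near: h; exact: nbhs_dnbhs_neq.
    apply: le_lt_trans (flat_bound n h) _; rewrite -real_normK ?num_real//.
    rewrite expr2 mulrCA ltr_pM2l; last first.
      by rewrite normr_gt0; near: h; exact: nbhs_dnbhs_neq.
    rewrite -ltr_pdivlMl ?ltr0n ?fact_gt0//; near: h.
    apply: dnbhs0_lt; by rewrite mulr_gt0// invr_gt0 ltr0n fact_gt0.
  split; last exact/cvg_lim.
  by apply/cvg_ex; exists 0.
Unshelve. all: by end_near.
Qed.
End Flat.

Section SmoothComposition.
Variables (R : realType) (n : nat).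
Implicit Types (U : set 'rV[R]_n) (f : 'rV[R]_n -> R).

Lemma derive_comp1 (g : R -> R) f (x v : 'rV[R]_n) d :
  differentiable f x -> is_derive (f x) 1 g d ->
  differentiable (g \o f) x /\ 'D_v (g \o f) x = d * 'D_v f x.
Proof.
move=> df [dg gE].
have dg' : differentiable g (f x) by exact/derivable1_diffP.
have dgf := differentiable_comp df dg'; split=> //.
by rewrite !deriveE// diff_comp//= diff1E//= derive1E gE /GRing.scale/= mulrC.
Qed.

(** Induction on the order for all [m] at once, since differentiating [flat m] yields [flat m.+1]
    and [flat m.+2]. *)
Lemma diff_upto_flat k m U f : open U -> diff_upto k U f ->
  diff_upto k U (flat m \o f).
Proof.
move=> oU; elim: k m f => [//|k IH] m f sf; have [df Df] := sf.
have E x v : U x -> differentiable (flat m \o f) x /\ _ :=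
  fun Ux => derive_comp1 v (df x Ux) (is_derive_flat m (f x)).
split=> [x Ux|i]; first by have [] := E x 0 Ux.
have sf' := diff_uptoW sf.
have := diff_uptoM oU (diff_uptoD oU (diff_uptoM oU (@smooth_rV_cst _ _ U (- m%:R) k)
  (IH m.+1 f sf')) (IH m.+2 f sf')) (Df i).
by apply: diff_upto_eq => // x Ux; have [_ ->] := E x (delta_mx 0 i) Ux.
Qed.

Lemma diff_uptoV k U f : open U -> (forall x, U x -> f x != 0) ->
  diff_upto k U f -> diff_upto k U (fun x => (f x)^-1).
Proof.
move=> oU; elim: k f => [//|k IH] f f0 sf; have [df Df] := sf.
split=> [x Ux|i]; first by apply: differentiableV; [exact: df|exact: f0].
have sV := IH f f0 (diff_uptoW sf).
have := diff_uptoM oU (diff_uptoM oU (@smooth_rV_cst _ _ U (- 1) k)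
  (diff_uptoM oU sV sV)) (Df i).
apply: diff_upto_eq => // x Ux; rewrite deriveV ?f0//; last first.
  by apply: diff_derivable; exact: df.
by rewrite -[LHS]/(-1 * ((f x)^-1 * (f x)^-1) * _) mulN1r -invrM ?unitfE ?f0.
Qed.

Lemma diff_upto_local k U f :
  (forall x, U x -> exists2 V : set 'rV[R]_n, V x & diff_upto k V f) ->
  diff_upto k U f.
Proof.
elim: k f => [//|k IH] f loc; split=> [x /loc[V Vx [df _]]|i]; first exact: df.
by apply: IH => x /loc[V Vx [_ Df]]; exists V => //; exact: Df.
Qed.
End SmoothComposition.

Section Bump.
Variables (R : realType) (M : smoothManifold R).
Implicit Types (U V W : set M) (f : M -> R).

Lemma smooth_on_flat m U f : open U -> smooth_on U f -> smooth_on U (flat m \o f).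
Proof.
by move=> oU sf c cM k; apply: diff_upto_flat (sf c cM k); exact: chart_image_open.
Qed.

Lemma smooth_onV U f : open U -> (forall x, U x -> f x != 0) -> smooth_on U f ->
  smooth_on U (fun x => (f x)^-1).
Proof.
move=> oU f0 sf c cM k; apply: diff_uptoV (sf c cM k).
  exact: chart_image_open.
by move=> _ [x [Ux Dx] <-] /=; have [_ _ _ _ ->] := mfd_chartP cM; rewrite ?f0.
Qed.

Lemma smooth_on_local U f :
  (forall x, U x -> exists2 W, W x & smooth_on W f) -> smooth_on U f.
Proof.
move=> loc c cM k; apply: diff_upto_local => _ [x [Ux Dx] <-].
have [W Wx sf] := loc x Ux; exists (chart_image c W); last exact: sf.
by exists x.
Qed.

Lemma smooth_on_prod U n (f : 'I_n -> M -> R) : open U ->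
  (forall i, smooth_on U (f i)) -> smooth_on U (fun x => \prod_i f i x).
Proof.
move=> oU sf.
suff h (s : seq 'I_n) : smooth_on U (fun x => \prod_(i <- s) f i x).
  exact: h.
elim: s => [|i s IH].
  apply: smooth_on_eq (@smooth_on_cst _ _ U 1) => // x Ux; rewrite big_nil//.
by apply: smooth_on_eq (smooth_onM oU (sf i) IH) => // x Ux; rewrite big_cons.
Qed.

(** A smooth step in a squared distance [s]: 1 up to [e ^+ 2 / 4] and 0 from [e ^+ 2] on. For
    [0 < e] the two terms of the denominator never vanish together. *)
Definition cutoff (e s : R) : R :=
  flat 0 (e ^+ 2 - s) * (flat 0 (e ^+ 2 - s) + flat 0 (s - e ^+ 2 / 4))^-1.

Lemma cutoff_denom_gt0 (e s : R) : 0 < e ->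
  0 < flat 0 (e ^+ 2 - s) + flat 0 (s - e ^+ 2 / 4).
Proof.
move=> e0; have e20 : 0 < e ^+ 2 by rewrite exprn_gt0.
have [se|es] := ltP s (e ^+ 2).
  by rewrite ltr_wpDr ?flat_ge0// flat_gt0// subr_gt0.
by rewrite ltr_wpDl ?flat_ge0// flat_gt0// subr_gt0; lra.
Qed.

Lemma cutoff1 (e s : R) : 0 < e -> s <= e ^+ 2 / 4 -> cutoff e s = 1.
Proof.
move=> e0 se; have := cutoff_denom_gt0 s e0.
rewrite /cutoff [flat 0 (s - _)]flat_le0 ?subr_le0// addr0 => h.
by rewrite mulfV// gt_eqF.
Qed.

Lemma cutoff0 (e s : R) : e ^+ 2 <= s -> cutoff e s = 0.
Proof. by move=> se; rewrite /cutoff flat_le0 ?mul0r// subr_le0. Qed.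

Lemma smooth_on_cutoff U (e : R) f : open U -> 0 < e -> smooth_on U f ->
  smooth_on U (fun x => cutoff e (f x)).
Proof.
move=> oU e0 sf.
have sN : smooth_on U (fun x => e ^+ 2 - f x).
  have := smooth_onD oU (@smooth_on_cst _ _ U (e ^+ 2))
    (smooth_onM oU (@smooth_on_cst _ _ U (-1)) sf).
  by apply: smooth_on_eq => // x _ /=; rewrite mulN1r.
have sP := smooth_onD oU sf (@smooth_on_cst _ _ U (- (e ^+ 2 / 4))).
have sA := smooth_on_flat 0 oU sN; have sB := smooth_on_flat 0 oU sP.
have sD := smooth_onD oU sA sB.
apply: smooth_on_eq (smooth_onM oU sA (smooth_onV oU _ sD)) => // x _.
by rewrite gt_eqF//; exact: cutoff_denom_gt0.
Qed.

(** A product of one-variable cut-offs in a chart vanishes outside the image [K] of a closed cube.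
    [K] is compact, hence closed as [M] is Hausdorff, so the extension by zero is smooth and [V] can
    be the complement of [K]. *)
Lemma smooth_bump (x0 : M) U : open U -> U x0 ->
  exists b : smoothFun M, exists V W, [/\ open V, U `|` V = setT,
    forall x, V x -> b x = 0 & [/\ open W, W x0 & forall x, W x -> b x = 1]].
Proof.
move=> oU Ux0; have [c cM Dx0] := mfd_cover x0.
have [oD oI cmap cinv cK] := mfd_chartP cM.
set u0 := chart_map c x0.
have : nbhs u0 (chart_image c U).
  by apply: open_nbhs_nbhs; split; [exact: chart_image_open|exists x0].
move=> /nbhs_ballP[e' /= e'0 e'U].
(* Halving the radius puts the closed cube inside the open ball. *)
pose e := e' / 2; have e0 : 0 < e by rewrite divr_gt0.
pose box := [set v : 'rV[R]_(mfd_dim M) |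
  forall i, `[u0 0 i - e, u0 0 i + e]%classic (v 0 i)].
have boxP v : box v <-> forall i, `|v 0 i - u0 0 i| <= e.
  by split=> h i; have := h i; rewrite /= in_itv/= ler_distl.
have boxU : box `<=` chart_image c U.
  move=> v /boxP bv; apply: e'U; split=> // i j; rewrite ord1 /ball/= distrC.
  by apply: le_lt_trans (bv j) _; rewrite /e; lra.
pose K := chart_inv c @` box.
have cK' : closed K.
  apply: compact_closed; first exact: mfd_hausdorff.
  have cbox : compact box.
    exact: (@rV_compact R _ (fun i => `[u0 0 i - e, u0 0 i + e]%classic)
      (fun i => @segment_compact R _ _)).
  refine (continuous_compact _ cbox).
  apply: continuous_subspaceW cinv => v /boxU [x [_ Dx] <-].
  by exists x.
have KU : K `<=` U `&` chart_dom c.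
  by move=> _ [v /boxU[x [Ux Dx] <-] <-]; rewrite cK.
pose s i y := (chart_map c y 0 i - u0 0 i) ^+ 2.
pose g y := \prod_i cutoff e (s i y).
have sg : smooth_on (chart_dom c) g.
  apply: smooth_on_prod => // i; apply: smooth_on_cutoff => //.
  have sc : smooth_on (chart_dom c) (fun y => chart_map c y 0 i).
    by move=> c' c'M; exact: mfd_compat.
  have sd := smooth_onD oD sc (@smooth_on_cst _ _ (chart_dom c) (- u0 0 i)).
  by apply: smooth_on_eq (smooth_onM oD sd sd) => // y _; rewrite /s expr2.
have g0 y : chart_dom c y -> ~ K y -> g y = 0.
  move=> Dy nK.
  have [i hi] : exists i, e < `|chart_map c y 0 i - u0 0 i|.
    apply/not_existsP => h; apply: nK; exists (chart_map c y); last exact: cK.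
    by apply/boxP => i; rewrite leNgt; apply/negP.
  rewrite /g (bigD1 i)//= cutoff0 ?mul0r//.
  by rewrite /s -(real_normK (num_real (_ - _))) ler_sqr ?nnegrE// ltW.
pose b y := if `[< chart_dom c y >] then g y else 0.
have b0 y : (~` K) y -> b y = 0.
  by move=> nK; rewrite /b; case: asboolP => // Dy; exact: g0.
have oK : open (~` K) by exact: closed_openC.
have sb : smooth_on setT b.
  apply: smooth_on_local => y _; have [Ky|nK] := pselect (K y).
    exists (chart_dom c); first by have [] := KU _ Ky.
    by apply: smooth_on_eq sg => // z Dz; rewrite /b asboolT.
  exists (~` K) => //.
  by apply: smooth_on_eq (@smooth_on_cst _ _ (~` K) 0) => // z /b0 ->.
(* Within [e / 2] of the centre each squared coordinate is at most [e ^+ 2 / 4], so every factor is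
   1. *)
have : nbhs x0 (chart_dom c `&` chart_map c @^-1` (ball u0 (e / 2))).
  apply: filterI; first exact: open_nbhs_nbhs.
  move: cmap; rewrite continuous_open_subspace// => cmap.
  by apply: (cmap x0); [rewrite inE|apply: nbhsx_ballx; rewrite divr_gt0].
rewrite nbhsE => -[W [oW Wx0] WP].
exists (SmoothFun sb), (~` K), W; split=> //=; last split=> //.
  apply/seteqP; split=> // y _; have [/KU[Uy _]|] := pselect (K y); first by left.
  by right.
move=> y /WP[Dy By]; rewrite /b asboolT//; apply: big1 => i _; apply: cutoff1 => //.
rewrite /s -(real_normK (num_real (_ - _))).
have -> : e ^+ 2 / 4 = (e / 2) ^+ 2 by field.
have e20 : 0 <= e / 2 by rewrite divr_ge0// ltW.
rewrite ler_sqr ?nnegrE//.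
by have /ltW := By.2 0 i; rewrite distrC.
Qed.
End Bump.

(** * Tensoriality *)

Section LocalSections.
Variables (R : realType) (M : smoothManifold R) (E : vectorBundle M).
Local Notation r := (vb_rank E).

Section Triv.
Variables (t : trivialization E r) (x : M).
Hypotheses (tE : vb_trivs t) (tx : triv_dom t x).

Lemma trivK : cancel (triv_map t) (triv_inv t x).
Proof. by have [_ /(_ x tx)[]] := vb_trivP tE. Qed.

Lemma triv_invK : cancel (triv_inv t x) (triv_map t).
Proof. by have [_ /(_ x tx)[]] := vb_trivP tE. Qed.

Lemma triv_inv_sum (v : 'rV[R]_r) :
  triv_inv t x v = \sum_i v 0 i *: triv_inv t x (delta_mx 0 i).
Proof.
apply: (can_inj trivK); rewrite triv_invK {1}[v]row_sum_delta.
rewrite (big_morph (@triv_map _ _ _ _ t x) (trivD tE tx) (triv0 tE tx)).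
by apply: eq_bigr => i _; rewrite trivZ// triv_invK.
Qed.
End Triv.

Variables (b : smoothFun M) (U V : set M).
Hypotheses (oU : open U) (oV : open V) (UV : U `|` V = setT).
Hypothesis bV : forall x, V x -> b x = 0.

Lemma smooth_cut (f : M -> R) : smooth_on U f -> smooth_on setT (fun x => b x * f x).
Proof.
move=> sf; apply: smooth_on_local => x _.
have : (U `|` V) x by rewrite UV.
move=> [Ux|Vx].
  exists U => //; apply: smooth_onM => //.
  by apply: smooth_onS (smooth_sfun b).
exists V => //.
by apply: smooth_on_eq (@smooth_on_cst _ _ V 0) => // y Vy; rewrite bV// mul0r.
Qed.

Lemma smooth_cut_frame t (v : 'rV[R]_r) : vb_trivs t -> triv_dom t = U ->
  smooth_section_on setT (fun x => b x *: (triv_inv t x v : E x)).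
Proof.
move=> tE tU t' t'E j; rewrite setTI.
have [ot' _] := vb_trivP t'E.
apply: smooth_on_local => x t'x.
have : (U `|` V) x by rewrite UV.
move=> [Ux|Vx].
  exists (U `&` triv_dom t') => //; have oI := openI oU ot'.
  have sb : smooth_on (U `&` triv_dom t') b by apply: smooth_onS (smooth_sfun b).
  have sv : smooth_on (U `&` triv_dom t') (fun x => triv_map t' (triv_inv t x v) 0 j).
    by rewrite -tU; exact: vb_compat.
  by apply: smooth_on_eq (smooth_onM oI sb sv) => // y [Uy t'y]; rewrite trivZ// mxE.
exists (V `&` triv_dom t') => //; have oI := openI oV ot'.
apply: smooth_on_eq (@smooth_on_cst _ _ _ 0) => // y [Vy t'y].
by rewrite bV// scale0r triv0// mxE.
Qed.
End LocalSections.

Lemma local_frame (R : realType) (M : smoothManifold R) (E : vectorBundle M)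
    (t : trivialization E (vb_rank E)) x0 : vb_trivs t -> triv_dom t x0 ->
  exists W, [/\ open W, W x0 & forall v, exists s : Gamma E,
     forall x, W x -> s x = triv_inv t x v].
Proof.
move=> tE tx0; have [oU _] := vb_trivP tE.
have [b [V [W [oV UV bV [oW Wx0 bW]]]]] := smooth_bump oU tx0.
exists W; split=> // v.
exists (MkSection (smooth_cut_frame oU oV UV bV v tE erefl)) => x Wx /=.
by rewrite bW// scale1r.
Qed.

Lemma section_through (R : realType) (M : smoothManifold R) (E : vectorBundle M)
    (x : M) (v : E x) : exists s : Gamma E, s x = v.
Proof.
have [t tE tx] := vb_cover E x.
have [W [_ Wx /(_ (triv_map t v))[s sE]]] := local_frame tE tx.
by exists s; rewrite sE// trivK.
Qed.

Lemma sec_sum (R : realType) (M : smoothManifold R) (E : vectorBundle M)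
    n (s : 'I_n -> Gamma E) x : (\sum_i s i) x = \sum_i s i x.
Proof. exact: (big_morph (fun s : Gamma E => s x) (fun _ _ => erefl) erefl). Qed.

Lemma secN (R : realType) (M : smoothManifold R) (E : vectorBundle M)
    (s : Gamma E) x : (- s) x = - s x.
Proof. by rewrite -[LHS]/((-1 * 1) *: s x) mulr1 scaleN1r. Qed.

Lemma secB (R : realType) (M : smoothManifold R) (E : vectorBundle M)
    (s s' : Gamma E) x : (s - s') x = s x - s' x.
Proof. by rewrite -secN. Qed.

Section Tensoriality.
Variables (R : realType) (M : smoothManifold R) (A : lieAlgebroid M).
Variable (E : vectorBundle M).
Implicit Types w : cochain A E.

(* Write [b ^ 2 z = sum_i (b z_i) (b e_i)] for a cut-off [b] with [b x = 1] and a
   local frame [e_i]. *)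
Lemma form_vanish w (z : Gamma A) t x : additive1 w -> scalar1 w ->
  z x = 0 -> w (z :: t) x = 0.
Proof.
move=> wD wZ zx0; have [tr trE trx] := vb_cover A x; have [oU _] := vb_trivP trE.
have [b [V [W [oV UV bV [oW Wx bW]]]]] := smooth_bump oU trx.
pose e i : Gamma A := MkSection (smooth_cut_frame oU oV UV bV (delta_mx 0 i) trE erefl).
have sz i : smooth_on (triv_dom tr) (fun y => triv_map tr (z y) 0 i).
  by have := smooth_sec z trE i; rewrite setTI.
pose f i : smoothFun M := SmoothFun (smooth_cut oU oV UV bV (sz i)).
have -> : w (z :: t) x = w (((b * b) *: z) :: t) x.
  by rewrite wZ -[RHS]/(b x * b x *: w (z :: t) x) bW// mul1r scale1r.
have -> : (b * b) *: z = \sum_i f i *: e i.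
  apply: GammaP => y; rewrite sec_sum.
  rewrite -[LHS]/((b y * b y) *: z y).
  have : (triv_dom tr `|` V) y by rewrite UV.
  move=> [ty|Vy].
    rewrite -{1}(trivK trE ty (z y)) (triv_inv_sum trE ty) scaler_sumr.
    apply: eq_bigr => i _.
    by rewrite -[RHS]/((b y * triv_map tr (z y) 0 i) *: (b y *: triv_inv tr y _))
       !scalerA mulrAC.
  rewrite bV// mul0r scale0r big1// => i _.
  by rewrite -[LHS]/((b y * _) *: (b y *: _)) bV// mul0r scale0r.
have -> : w (\sum_i f i *: e i :: t) = \sum_i f i *: w (e i :: t).
  rewrite (big_morph (fun s => w (s :: t)) (fun _ _ => wD _ _ _) (additive1_0 _ wD)).
  by apply: eq_bigr => i _; exact: wZ.
rewrite sec_sum big1// => i _.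
by rewrite -[LHS]/((b x * triv_map tr (z x) 0 i) *: w (e i :: t) x) zx0
  triv0// mxE mulr0 scale0r.
Qed.

(** Arguments are exchanged one at a time: their difference vanishes at [x], so [form_vanish]
    applies. *)
Lemma form_pointwise w (Z Z' : seq (Gamma A)) x : alternating w -> scalar1 w ->
  size Z = size Z' -> (forall i, (i < size Z)%N -> Z`_i x = Z'`_i x) ->
  w Z x = w Z' x.
Proof.
elim: Z Z' w => [|z Z IH] [|z' Z'] //= w wA wZ [sZ] ZZ'.
have -> : w (z :: Z) x = w (z' :: Z) x.
  apply/eqP; rewrite -subr_eq0; apply/eqP.
  have : w (z - z' :: Z) x = 0.
    apply: form_vanish => //; first by case: wA.
    by rewrite secB (ZZ' 0%N)// subrr.
  by rewrite wA.2 (additive1_N _ _ wA.2) secB.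
apply: (IH Z' (iota_ z' w)) => //; [exact: alt_iota|exact: scalar1_iota|].
by move=> i; exact: (ZZ' i.+1).
Qed.

Lemma alt_move w s z t : alternating w ->
  w (s ++ z :: t) = sg (odd (size s)) (w (z :: s ++ t)).
Proof.
elim: s w => [//|y s IH] w wA; rewrite cat_cons -[LHS]/(iota_ y w (s ++ z :: t)).
rewrite IH; last exact: alt_iota.
rewrite /iota_ (wA.1 [::]) /=; case: (odd _); rewrite //= opprK//.
Qed.

Lemma alt_perm w n (s : 'S_n) (Z : seq (Gamma A)) : alternating w -> size Z = n ->
  w (perm_seq Z s) = sg (odd_perm s) (w Z).
Proof.
move=> wA sZ; subst n; elim: Z w wA s => [|z Z IH] w wA s.
  rewrite (_ : s = 1%g); last by apply/permP => -[].
  by rewrite odd_perm1 /perm_seq (size0nil (size_enum_ord 0)).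
have [s' ->] := lift_perm_surj (s^-1%g ord0) s; rewrite permKV.
set i0 := s^-1%g _; rewrite perm_seq_lift alt_move// cat_take_drop.
rewrite -[w (z :: _)]/(iota_ z w _) IH; last exact: alt_iota.
have i0Z : (i0 <= size (perm_seq Z s'))%N by rewrite size_perm_seq -ltnS.
rewrite odd_lift_perm size_takel//= addbF.
by case: (odd _); case: (odd_perm _); rewrite //= opprK.
Qed.

(** The tensor at [x] is [w] evaluated on sections through the given vectors. By [form_pointwise]
    the choice is immaterial, so each property is checked on a convenient choice ([TE]). *)
Lemma Omega_of_form k w : (forall Z, size Z <> k -> w Z = 0) ->
  alternating w -> scalar1 w -> Omega k w.
Proof.
move=> wk wA wZ; split=> //.
pose S x (v : 'I_k -> A x) : seq (Gamma A) :=
  [seq sval (cid (section_through (v i))) | i <- enum 'I_k].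
have sS x v : size (@S x v) = k by rewrite size_map size_enum_ord.
have nS x v (i : 'I_k) : (@S x v)`_i x = v i.
  by rewrite (nth_map i) ?size_enum_ord// nth_ord_enum; case: cid.
pose T x v := w (@S x v) x.
have TE x v (Z : seq (Gamma A)) : size Z = k ->
    (forall i : 'I_k, Z`_i x = v i) -> T x v = w Z x.
  move=> sZ Zv; apply: form_pointwise; rewrite ?sS// => i ik.
  by rewrite -[i]/(nat_of_ord (Ordinal ik)) nS Zv.
exists T; last by move=> Z x sZ; apply/esym/TE.
split=> [x|t tA v].
  split=> [v i a u y|v s]; last first.
    rewrite (@TE x _ (perm_seq (S x v) s)) ?size_perm_seq//; last first.
      by move=> i; rewrite nth_perm_seq nS.
    rewrite alt_perm// /T; case: (odd_perm s); last by rewrite expr0 scale1r.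
    by rewrite expr1 scaleN1r -secN.
  (* Sections through [v] with the one in slot [i] replaced by [z]. *)
  pose P z := take i (S x v) ++ z :: drop i.+1 (S x v).
  have sP z : size (P z) = k.
    by rewrite size_cat /= size_take size_drop sS ltn_ord; have := ltn_ord i; lia.
  have nP z (j : 'I_k) : (P z)`_j x = [eta v with i |-> z x] j.
    rewrite nth_cat size_take sS ltn_ord /=; case: (ltngtP j i) => ji.
    - by rewrite nth_take// nS; case: eqP => // ij; move: ji; rewrite ij ltnn.
    - have -> : (j - i = (j - i.+1).+1)%N by lia.
      rewrite /= nth_drop subnKC// nS; case: eqP => // ij.
      by move: ji; rewrite ij ltnn.
    - by rewrite ji subnn /= (val_inj ji) eqxx.
  have [su <-] := section_through u; have [sy <-] := section_through y.
  have PT (z : Gamma A) : T x [eta v with i |-> z x] = w (P z) x.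
    by apply: TE; [exact: sP|exact: nP].
  rewrite -[a *: su x + sy x]/((a%:Sf *: su + sy) x) !PT /P !alt_move//.
  have lin (p q : Gamma E) : (a%:Sf *: p + q) x = a *: p x + q x by [].
  rewrite wA.2 wZ /sg; case: (odd _); rewrite ?secN lin//.
  by rewrite opprD scalerN.
move=> t' t'E j; have [ot _] := vb_trivP tA; have [ot' _] := vb_trivP t'E.
apply: smooth_on_local => x0 [tx0 t'x0].
(* Near [x0] the frame vectors extend to global sections [e i], on which [w] is smooth. *)
have [W [oW Wx0 /(_ (v _))/cid fr]] := local_frame tA tx0.
pose e i := sval (fr i).
have eE i x : W x -> e i x = triv_inv t x (v i) := svalP (fr i) x.
exists (W `&` triv_dom t') => //; have oI := openI oW ot'.
pose Z := [seq e i | i <- enum 'I_k].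
have sZ : smooth_on (W `&` triv_dom t') (fun x => triv_map t' (w Z x) 0 j).
  by apply: smooth_onS (smooth_sec (w Z) t'E j) => x [].
apply: smooth_on_eq sZ => // x [Wx _].
rewrite (@TE x _ Z)//; first by rewrite size_map size_enum_ord.
by move=> i; rewrite (nth_map i) ?size_enum_ord// nth_ord_enum eE.
Qed.
End Tensoriality.

(** * Elements of [Omega] as alternating forms *)

Section FormOfOmega.
Variables (R : realType) (M : smoothManifold R) (A : lieAlgebroid M).
Variables (E : vectorBundle M) (k : nat) (w : cochain A E).
Hypothesis wO : Omega k w.

Lemma Omega_hom Z : size Z <> k -> w Z = 0.
Proof. by have [h _] := wO; exact: h. Qed.

Lemma Omega_slot0 (a : smoothFun M) x y t :
  w (a *: x + y :: t) = a *: w (x :: t) + w (y :: t).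
Proof.
have [kt|kt] := eqVneq (size t).+1 k; last first.
  by rewrite !Omega_hom ?scaler0 ?addr0//; exact/eqP.
have [_ [T [Tms _] wT]] := wO; apply: GammaP => p.
rewrite -[RHS]/(a p *: w (x :: t) p + w (y :: t) p) !wT//.
have [Tl _] := Tms p; move: T {wT Tms} Tl; rewrite -kt => T Tl.
have h z : (fun i : 'I_(size t).+1 => (z :: t)`_i p)
    = [eta (fun i : 'I_(size t).+1 => (x :: t)`_i p) with ord0 |-> z p].
  by apply/funext => i /=; case: (unliftP ord0 i) => [j|] ->.
by rewrite (h (a *: x + y)); apply: etrans (Tl _ _ _ _ _) _; rewrite -!h.
Qed.

Lemma Omega_additive1 : additive1 w.
Proof. by move=> x y t; have := Omega_slot0 1 x y t; rewrite !scale1r. Qed.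

Lemma Omega_scalar1 : scalar1 w.
Proof.
move=> c x t; have := Omega_slot0 c x 0 t.
by rewrite addr0 (additive1_0 _ Omega_additive1) addr0.
Qed.

Lemma Omega_alternating : alternating w.
Proof.
split; last exact: Omega_additive1.
move=> s x y t; have [sk|sk] := eqVneq (size (s ++ [:: x, y & t])) k; last first.
  have sk' : size (s ++ [:: y, x & t]) != k by move: sk; rewrite !size_cat.
  by rewrite !Omega_hom ?oppr0//; exact/eqP.
have sk' : size (s ++ [:: y, x & t]) = k by rewrite -sk !size_cat.
have [_ [T [Tms _] wT]] := wO; apply: GammaP => p.
rewrite secN !wT//.
have ik : (size s < k)%N by rewrite -sk size_cat /=; lia.
have jk : ((size s).+1 < k)%N by rewrite -sk size_cat /=; lia.
(* Skew-symmetry of the tensor, for the transposition of the two slots following [s]. *)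
have [_ /(_ (fun i => (s ++ [:: y, x & t])`_i p))] := Tms p.
move=> /(_ (tperm (Ordinal ik) (Ordinal jk))).
rewrite odd_tperm -val_eqE /= (ltn_eqF (ltnSn _)) /= expr1 scaleN1r => <-.
congr (T p _); apply/funext => i /=.
case: tpermP => [->|->|/eqP h1 /eqP h2] /=; rewrite !nth_cat.
- by rewrite ltnn subnn ltnNge leqnSn /= subSnn.
- by rewrite ltnn subnn ltnNge leqnSn /= subSnn.
move: h1 h2; rewrite -!val_eqE /=; case: ltnP => // si h1 h2.
have -> : (i - size s)%N = (i - size s - 2).+2.
  have aux (m n : nat) : (n <= m)%N -> m <> n -> m <> n.+1 ->
      (m - n = (m - n - 2).+2)%N.
    by lia.
  by apply: aux => //; exact/eqP.
by [].
Qed.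

Lemma Omega_parity : parity (odd k) w.
Proof. by move=> Z h; apply: Omega_hom => e; rewrite e eqxx in h. Qed.
End FormOfOmega.

(** The exact degree, as opposed to [parity]; needed to identify shuffle sums and to land in
    [Omega]. *)
Definition homogeneous (L V : zmodType) k (w : seq L -> V) :=
  forall Z, size Z <> k -> w Z = 0.

Section Homogeneous.
Variables (L V : zmodType).
Implicit Types (f : seq L -> L) (w : seq L -> V).

Lemma hom_ins k l f w : homogeneous k f -> homogeneous l w -> additive1 w ->
  homogeneous (k + l).-1 (ins f w).
Proof.
move=> fk wl wD Z hZ; apply: split_sum0 => Y Y' e.
have [oY|/eqP oY] := eqVneq (size Y) k; last by rewrite fk// additive1_0.
by apply: wl => /= oY'; apply: hZ; rewrite -e oY -oY' addnS.
Qed.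

Lemma hom_D_along nL (nV : L -> V -> V) k l f w : biadditive nL -> biadditive nV ->
  homogeneous k f -> homogeneous l w -> additive1 w ->
  homogeneous (k + l) (D_along nL nV f w).
Proof.
move=> nLB nVB fk wl wD Z hZ; apply: split_sum0 => Y Y' e.
have [oY|/eqP oY] := eqVneq (size Y) k; last by rewrite fk// cov_der0l.
have oY' : size Y' <> l by move=> oY'; apply: hZ; rewrite -e oY oY'.
rewrite /cov_der !funE wl// biadd0r// add0r.
rewrite (@hom_ins 1 l) ?oppr0//; by move=> [|? []].
Qed.
End Homogeneous.

(** * Shuffle operators expressed through splittings *)

Section LieDerivativeAsIns.
Variables (R : realType) (M : smoothManifold R) (A : lieAlgebroid M).

Lemma connection_biadditive (E : vectorBundle M) (n : connection A E) :
  biadditive (cov n).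
Proof.
split=> [s x y|x s t].
  have := cov_Clinear n 1 x y s; rewrite !scale1r; exact.
have := cov_Rlinear n x 1 s t; rewrite -[1%:Sf]/(1 : smoothFun M) !scale1r; exact.
Qed.

Lemma connection_scale (E : vectorBundle M) (n : connection A E) c x s :
  n (c *: x) s = c *: n x s.
Proof.
have := cov_Clinear n c x 0 s.
by rewrite addr0 (biadd0l (connection_biadditive n)) addr0.
Qed.

Variables (nabla : connection A A) (E : vectorBundle M) (nE : connection A E).
Hypothesis tf : torsion_free nabla.
Implicit Types (f : cochain A A) (w : cochain A E).
Local Notation id1 := (one_form (@id (Gamma A))).
Local Notation D := (D_along (cov nabla) (cov nE)).

Lemma d_nablaE w : alternating w -> d_nabla nE w = D id1 w.
Proof.
move=> wA; apply/funext => Z; rewrite /d_nabla !shuffle_sumE.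
apply: d_split_sum => //; exact: connection_biadditive.
Qed.

Lemma insertionE k f w : homogeneous k f -> additive1 w -> insertion k f w = ins f w.
Proof.
move=> fk wD; apply/funext => Z; rewrite /insertion shuffle_sumE.
apply: eq_split_sum => Y Y' _; case: eqP => // Yk.
by rewrite fk// additive1_0.
Qed.

Lemma mulrz_sign (V : zmodType) (z : int) (v : V) : v *~ (-1) ^ z = sg (odd `|z|%N) v.
Proof.
case: z => n.
  rewrite -[(-1) ^ n]/((-1) ^+ n) -signr_odd.
  by case: odd; rewrite ?expr0 ?expr1 ?mulrN1z ?mulr1z.
rewrite /absz -[(-1) ^ Negz n]/(((-1 : int) ^+ n.+1)^-1) -signr_odd.
by case: odd; rewrite ?expr0 ?expr1 ?invr1 ?invrN1 ?mulrN1z ?mulr1z.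
Qed.

Lemma lie_nablaE k f w : homogeneous k f -> alternating f -> alternating w ->
  lie_nabla nE k f w = lie_der (cov nabla) (cov nE) (odd k) f w.
Proof.
move=> fk fA wA; have nB := connection_biadditive nabla.
have nEB := connection_biadditive nE.
have fp : parity (odd k) f by move=> Z h; apply: fk => e; rewrite e eqxx in h.
have fwA := alt_ins fp fA wA.
have dA := alt_D_along nB nEB (par_one_form id) (alt_id1 _) wA.
rewrite /lie_nabla /gcomm d_nablaE// insertionE//; last by case: dA.
rewrite insertionE//; last by case: wA.
rewrite d_nablaE// mulrz_sign mulr1.
(* For [k = 0] the integer is -1, still of parity opposite to [k]. *)
have -> : odd `|k%:Z - 1|%N = ~~ odd k.
  by case: k {fk fp} => // k; rewrite -addn1 PoszD addrK /= addn1/= negbK.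
by case: odd => //=; rewrite opprK.
Qed.
End LieDerivativeAsIns.

(** By [lie_der_D_along] this is a covariant derivation plus an insertion, and both summands are
    alternating, linear over functions and of degree [p + q]. *)
Lemma Omega_lie_der (R : realType) (M : smoothManifold R) (A : lieAlgebroid M)
    (nabla : connection A A) p q (f g : cochain A A) : Omega p f -> Omega q g ->
  Omega (p + q) (lie_der (cov nabla) (cov nabla) (odd p) f g).
Proof.
move=> fO gO; have nB := connection_biadditive nabla.
have idp := par_one_form (@id (Gamma A)); have idA := alt_id1 (Gamma A).
have fA := Omega_alternating fO; have gA := Omega_alternating gO.
have fp := Omega_parity fO; have gp := Omega_parity gO.
have fh := Omega_hom fO; have gh := Omega_hom gO.
have dA := alt_D_along nB nB idp idA fA.
have dp := par_D_along nB nB idp fp fA.2.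
have nZ c x (y : Gamma A) : nabla (c *: x) y = c *: nabla x y.
  exact: connection_scale.
have nr c x (y : Gamma A) : nabla x (c *: y) = rho x c *: y + c *: nabla x y.
  exact: cov_leibniz.
have idZ : scalar1 (one_form (@id (Gamma A))) by move=> c x [|? ?] /=; rewrite ?scaler0.
have idh : homogeneous 1 (one_form (@id (Gamma A))) by move=> [|? []].
have fZ := Omega_scalar1 fO; have gZ := Omega_scalar1 gO.
have dZ := scalar1_D_along nB nB nZ nZ nr nr idp fA idZ fZ.
rewrite (lie_der_D_along nB nB fp fA gA).
apply: Omega_of_form.
- move=> Z hZ; rewrite !funE (hom_D_along nB nB fh gh gA.2)// add0r.
  rewrite (hom_ins (hom_D_along nB nB idh fh fA.2) gh gA.2) ?sg0//.
- apply: altD; first exact: alt_D_along fp fA gA.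
  by apply: alt_sg; exact: alt_ins dp dA gA.
- apply: scalar1D; first exact: (scalar1_D_along nB nB nZ nZ nr nr fp gA fZ gZ).
  by apply: scalar1_sg; exact: (scalar1_ins dp gA dZ gZ).
Qed.

Lemma OmegaB (R : realType) (M : smoothManifold R) (A : lieAlgebroid M)
    (E : vectorBundle M) k b (v w : cochain A E) :
  Omega k v -> Omega k w -> Omega k (v - sg b w).
Proof.
move=> vO wO; apply: Omega_of_form.
- move=> Z hZ; rewrite !funE (Omega_hom vO)// (Omega_hom wO)// sg0 subr0//.
- apply: altD; first exact: Omega_alternating vO.
  by apply: altN; apply: alt_sg; exact: Omega_alternating wO.
- apply: scalar1D; first exact: Omega_scalar1 vO.
  by apply: scalar1N; apply: scalar1_sg; exact: Omega_scalar1 wO.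
Qed.

(** * Injectivity of insertion *)

Section Injectivity.
Variables (R : realType) (M : smoothManifold R) (A : lieAlgebroid M).

(** Inserting [f] into a 1-form [a] is applying [a] to the values of [f]. A cut-off times a
    coordinate of a local trivialization is such an [a], and these detect all coordinates at [x]. *)
Lemma ins_inj (f g : cochain A A) :
  (forall w : cochain A (line_bundle M), Omega 1 w -> ins f w = ins g w) -> f = g.
Proof.
move=> fg; apply/funext => Z; apply: GammaP => x.
have [t tE tx] := vb_cover A x; have [oU _] := vb_trivP tE.
have [b [V [W [oV UV bV [oW Wx bW]]]]] := smooth_bump oU tx.
apply: (can_inj (trivK tE tx)); apply/rowP => j.
have sz (z : Gamma A) : smooth_on (triv_dom t) (fun y => triv_map t (z y) 0 j).
  by have := smooth_sec z tE j; rewrite setTI.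
pose h (z : Gamma A) : smoothFun M := SmoothFun (smooth_cut oU oV UV bV (sz z)).
have hlin (c : smoothFun M) z y : h (c *: z + y) = c * h z + h y.
  apply: smoothFunP => p.
  rewrite -[LHS]/(b p * triv_map t (c p *: z p + y p) 0 j).
  rewrite -[RHS]/(c p * (b p * triv_map t (z p) 0 j) + b p * triv_map t (y p) 0 j).
  have : (triv_dom t `|` V) p by rewrite UV.
  move=> [tp|Vp]; last by rewrite bV// !mul0r mulr0 addr0.
  by rewrite triv_linear// !mxE; ring.
pose a : cochain A (line_bundle M) := one_form (fun z => sec_of_fun (h z)).
have aO : Omega 1 a.
  apply: Omega_of_form.
  - by move=> [|? []].
  - apply: alt_one_form => z y; rewrite -[z]scale1r hlin mul1r scale1r.
    exact: GammaP.
  - move=> c z [|? ?] /=; last by rewrite scaler0.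
    have := hlin c z 0; rewrite addr0 => ->.
    have h0 : h 0 = 0 by have := hlin (-1) 0 0; rewrite scaler0 addr0 mulN1r addNr.
    by rewrite h0 addr0; exact: GammaP.
have ia (f' : cochain A A) : ins f' a Z = sec_of_fun (h (f' Z)).
  by rewrite /ins split_sum_whole.
have := congr1 (fun w : cochain A (line_bundle M) => w Z x) (fg a aO).
rewrite !ia -[LHS]/(b x * _) -[RHS]/(b x * _) bW// !mul1r; exact.
Qed.
End Injectivity.

Theorem theorem5 (R : realType) (M : smoothManifold R) (A : lieAlgebroid M)
    (k l : nat) (phi psi : cochain A A) (nabla : connection A A) :
  Omega k phi -> Omega l psi -> torsion_free nabla ->
  forall chi : cochain A A,
    is_FN_bracket k l phi psi chi <->
    chi = lie_nabla nabla k phi psi - lie_nabla nabla l psi phi *~ (-1) ^+ (k * l).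
Proof.
move=> phiO psiO tf chi.
have phiA := Omega_alternating phiO; have psiA := Omega_alternating psiO.
have phip := Omega_parity phiO; have psip := Omega_parity psiO.
have phih := Omega_hom phiO; have psih := Omega_hom psiO.
have nB := connection_biadditive nabla.
have rB := connection_biadditive (connection_rho A).
have idp := par_one_form (@id (Gamma A)); have idA := alt_id1 (Gamma A).
rewrite (lie_nablaE nabla tf phih phiA psiA) (lie_nablaE nabla tf psih psiA phiA).
rewrite -[(-1) ^+ (k * l)]/((-1) ^ ((k * l)%N : int)) mulrz_sign oddM.
set chi0 := _ - _.
have chi0O : Omega (k + l) chi0.
  apply: OmegaB; first exact: Omega_lie_der.
  by rewrite addnC; exact: Omega_lie_der.
(* The defining identity for [chi0], an instance of [lie_der_ins] with the connection
   [connection_rho A] on values. *)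
have key m (w : cochain A (line_bundle M)) : Omega m w ->
  gcomm k%:Z (l%:Z - 1) (lie_nabla (connection_rho A) k phi) (insertion l psi) w
  = ins chi0 w
      - lie_nabla (connection_rho A) (k + l).-1 (insertion l psi phi) w
          *~ (-1) ^ (k%:Z * (l%:Z - 1)).
  move=> wO; have wA := Omega_alternating wO; have wD := wA.2.
  have pwA := alt_ins psip psiA wA.
  have ppA := alt_ins psip psiA phiA.
  have pph := hom_ins psih phih phiA.2.
  rewrite /gcomm !mulrz_sign (insertionE psih wD) (insertionE psih phiA.2).
  rewrite (lie_nablaE _ tf phih phiA pwA) (lie_nablaE _ tf phih phiA wA).
  have dwA := alt_D_along nB rB idp idA wA.
  have fwA := alt_ins phip phiA wA.
  rewrite (insertionE psih); last first.
    have dfA := alt_D_along nB rB idp idA fwA.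
    by case: (altD (alt_ins phip phiA dwA) (alt_sg (odd k) dfA)).
  have -> : odd (absz (k%:Z * (l%:Z - 1))) = odd k && ~~ odd l.
    rewrite abszM oddM /=; congr andb.
    by case: (l) => // n; rewrite -addn1 PoszD addrK /= addn1/= negbK.
  rewrite (lie_der_ins nB rB phip psip phiA psiA wA); congr (_ - sg _ _).
  rewrite addnC in pph; rewrite (lie_nablaE _ tf pph ppA wA).
  (* For [k = l = 0] the truncated predecessor has the wrong parity, but then [ins psi phi] is zero
     and both Lie derivatives vanish. *)
  have [kl|kl] := posnP (k + l)%N; last first.
    have -> : odd (k + l).-1 = ~~ (odd k (+) odd l).
      by rewrite -oddD -{2}(prednK kl) /= negbK.
    by [].
  have [k0 l0] : k = 0%N /\ l = 0%N by lia.
  have -> : ins psi phi = 0.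
    by apply/funext => Z; apply: split_sum0 => Y Y' _; rewrite phih// k0.
  by rewrite /lie_der (ins0l dwA.2) (ins0l wD) (D_along0r _ rB) !sg0.
split=> [[chiO chiE]|->].
  (* Uniqueness: on 1-forms the common Lie derivative term cancels, leaving equal insertions. *)
  apply: ins_inj => w wO; have := chiE 1%N w wO; rewrite (key 1%N w wO).
  rewrite (insertionE (Omega_hom chiO)); last by case: (Omega_alternating wO).
  by move/addIr.
split=> // m w wO; rewrite (key m w wO); congr (_ - _).
by rewrite (insertionE (Omega_hom chi0O))//; case: (Omega_alternating wO).
Qed.
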